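(* Let $\phi:A\rightarrow\mathbb{F}_q[F]$ be a Drinfeld module. Let $K$ be a regular extension of $\mathbb{F}_q$. Let $g$ be a positive integer. Let $\Gamma$ be a finitely generated $A[F]$-submodule of $\mathbb{G}_a^g(K)$ and let $X$ be a (closed) affine subvariety of $\mathbb{G}_a^g$ defined over $K$. Then $X(K)\cap\Gamma$ is a finite union of $F$-sets in $\Gamma$ (based in $\mathbb{G}_a^g(K^{\mathrm{alg}})$).
   Context: Let $p$ be a prime and $q$ a power of $p$. Let $C$ be a projective nonsingular curve defined over $\mathbb{F}_q$ with a fixed closed point $\infty$, and let $A$ be the ring of $\mathbb{F}_q$-valued functions on $C$ regular away from $\infty$ (a Dedekind domain, finite over some $\mathbb{F}_q[t]$). $F$ denotes the Frobenius $x\mapsto x^q$. A Drinfeld module (defined over $\mathbb{F}_q$) is a ring homomorphism $\phi:A\to\mathbb{F}_q[F]$, $a\mapsto\phi_a$, such that for some $a\in A$, $\phi_a\notin\mathbb{F}_q\cdot F^0$ (i.e. $\phi_a$ has positive degree as a polynomial in $F$). For a field extension $L$ of $\mathbb{F}_q$, $A$ acts on $\mathbb{G}_a(L)$ by $a*x=\phi_a(x)$, and diagonally on $\mathbb{G}_a^g(L)$; $F$ acts coordinatewise and commutes with all $\phi_a$. Identifying $A$ with its image $\phi(A)$, $A[F]\subset\operatorname{End}(\phi)$ is the extension of $A$ generated by $F$ (it is isomorphic to $\mathbb{F}_q[F]$); thus $\mathbb{G}_a^g(L)$ is an $A[F]$-module. $K^{\mathrm{alg}}$ is a fixed algebraic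 closure of $K$; $\mathbb{N}=\{0,1,2,\dots\}$, $\mathbb{N}^*=\mathbb{N}\setminus\{0\}$. Put $M:=\mathbb{G}_a^g(K^{\mathrm{alg}})$. A groupless $F$-set based in $M$ is a set of the form $$b+\Big\{\sum_{i=1}^kF^{\delta_in_i}a_i\;\Big|\;(n_1,\dots,n_k)\in\mathbb{N}^k\Big\}$$ with $b,a_1,\dots,a_k\in M$ and $\delta_1,\dots,\delta_k\in\mathbb{N}^*$; $k=0$ is allowed, giving the single point $\{b\}$. For a subgroup $\Gamma\subset M$, an $F$-set in $\Gamma$ based in $M$ is a set $C+H$, where $C\subset\Gamma$ is a groupless $F$-set based in $M$ and $H$ is a subgroup of $\Gamma$ invariant under $F$. *)

(* Defs.v *)
From HB Require Import structures.
From mathcomp Require Import all_boot all_order all_algebra.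
From mathcomp Require Import mpoly.

Set Implicit Arguments.
Unset Strict Implicit.
Unset Printing Implicit Defensive.

Import GRing.Theory.
Local Open Scope ring_scope.

(* Since a finite field k has q = #|k| elements, q is always written #|k|. *)

Section Fields.
Variables (k L : fieldType) (i : {rmorphism k -> L}).

Definition algebraic_closure_of : Prop :=
  GRing.closed_field_axiom L /\ forall x : L, algebraicOver i x.

Definition lin_indep (m : nat) (x : 'I_m -> L) : Prop :=
  forall c : 'I_m -> k, \sum_(l < m) i (c l) * x l = 0 -> forall l, c l = 0.

End Fields.

(* K / k is regular: inside the algebraic closure L of K, the fields K and
   k^alg (the elements of L algebraic over k) are linearly disjoint over k. *)
Definition regular_extension (k K L : fieldType)
    (iK : {rmorphism k -> K}) (iL : {rmorphism K -> L}) : Prop :=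
  forall (m : nat) (x : 'I_m -> K), lin_indep iK x ->
  forall c : 'I_m -> L,
    (forall l, algebraicOver (fun a => iL (iK a)) (c l)) ->
    \sum_(l < m) c l * iL (x l) = 0 -> forall l, c l = 0.

Section Curve.

Variables (k kb : fieldType) (ib : {rmorphism k -> kb}).
Variables (n : nat) (S : seq {mpoly k[n.+1]}).
Variables (E : fieldType) (iE : {rmorphism k -> E}) (xi : 'I_n.+1 -> E).

(* Value of a polynomial over k at a point with coordinates in L. *)
Definition evalp (L : fieldType) (i : {rmorphism k -> L}) (m : nat)
  (y : 'I_m -> L) (f : {mpoly k[m]}) : L := mmap i y f.

(* C is the closed subset of P^n defined by the homogeneous system S; a point
   over kb = k^alg is given by a vector of homogeneous coordinates. *)
Definition on_curve (y : 'I_n.+1 -> kb) : Prop :=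
  (exists l, y l != 0) /\ forall f, f \in S -> evalp ib y f = 0.

Definition homogeneous_system : Prop :=
  forall f, f \in S -> exists d, f \is d.-homog.

Definition vanishes_on_curve (f : {mpoly k[n.+1]}) : Prop :=
  forall y, on_curve y -> evalp ib y f = 0.

(* E is the function field of C, and xi is the generic point of C: a
   homogeneous f vanishes on C iff it vanishes at xi, and E consists of the
   quotients of homogeneous polynomials of the same degree at xi.  Such a pair
   (E, xi) exists exactly when C is irreducible over k. *)
Definition is_function_field : Prop :=
  (forall d f, f \is d.-homog -> (evalp iE xi f = 0 <-> vanishes_on_curve f)) /\
  (forall x : E, exists d f g,
     [/\ f \is d.-homog, g \is d.-homog, evalp iE xi g != 0
       & x = evalp iE xi f / evalp iE xi g]).

(* E has transcendence degree 1 over k. *)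
Definition dimension_one : Prop :=
  exists2 t : E, ~ algebraicOver iE t &
    forall x : E, exists2 P : {poly {poly k}}, P != 0 &
      root (map_poly (fun c : {poly k} => (map_poly iE c).[t]) P) x.

(* The local ring of C at (the closed point of) y, as a subring of E, and its
   maximal ideal. *)
Definition local_ring (y : 'I_n.+1 -> kb) (x : E) : Prop :=
  exists d f g, [/\ f \is d.-homog, g \is d.-homog, evalp ib y g != 0
                  & x = evalp iE xi f / evalp iE xi g].

Definition local_maximal_ideal (y : 'I_n.+1 -> kb) (x : E) : Prop :=
  exists d f g, [/\ f \is d.-homog, g \is d.-homog, evalp ib y g != 0,
                    evalp ib y f = 0 & x = evalp iE xi f / evalp iE xi g].

(* The (one-dimensional) local ring at y is regular: its maximal ideal is
   generated by one element. *)
Definition nonsingular_at (y : 'I_n.+1 -> kb) : Prop :=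
  exists2 u, local_maximal_ideal y u &
    forall x, local_maximal_ideal y x -> exists2 v, local_ring y v & x = u * v.

Definition nonsingular_projective_curve : Prop :=
  [/\ homogeneous_system, is_function_field, dimension_one
    & forall y, on_curve y -> nonsingular_at y].

(* A closed point of C is a homogeneous prime ideal; y and z lie on the same
   closed point iff they have the same homogeneous prime ideal. *)
Definition same_closed_point (y z : 'I_n.+1 -> kb) : Prop :=
  forall d f, f \is d.-homog -> (evalp ib y f = 0 <-> evalp ib z f = 0).

Definition regular_away_from (yoo : 'I_n.+1 -> kb) (x : E) : Prop :=
  forall y, on_curve y -> ~ same_closed_point y yoo -> local_ring y x.

(* The ring A, embedded in E by j, is the ring of functions on C regular away
   from the closed point of yoo. *)
Definition is_ring_regular_away (yoo : 'I_n.+1 -> kb)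
    (A : comNzRingType) (j : {rmorphism A -> E}) : Prop :=
  injective j /\ forall x, (exists a, j a = x) <-> regular_away_from yoo x.

End Curve.

(* As F commutes with the elements of k, the ring k[F] is the commutative
   polynomial ring {poly k}, with 'X standing for F. *)
Definition is_drinfeld_module (k : finFieldType) (A : comNzRingType)
    (phi : {rmorphism A -> {poly k}}) : Prop :=
  exists a : A, forall c : k, phi a <> c%:P.

Definition frob (k : finFieldType) (L : fieldType) (g : nat)
  (v : 'rV[L]_g) : 'rV[L]_g := map_mx (fun x => x ^+ #|k|) v.

(* P = \sum_l c_l F^l in k[F] acts by v |-> \sum_l c_l F^l(v). *)
Definition skew_act (k : finFieldType) (L : fieldType) (i : {rmorphism k -> L})
    (g : nat) (P : {poly k}) (v : 'rV[L]_g) : 'rV[L]_g :=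
  \sum_(l < size P) i P`_l *: iter l (@frob k L g) v.

Definition is_subgroup (V : zmodType) (H : V -> Prop) : Prop :=
  H 0 /\ forall x y, H x -> H y -> H (x - y).

Section Submodules.

Variables (k : finFieldType) (A : comNzRingType) (phi : {rmorphism A -> {poly k}}).
Variables (K : fieldType) (iK : {rmorphism k -> K}) (g : nat).

Definition is_AF_submodule (G : 'rV[K]_g -> Prop) : Prop :=
  [/\ is_subgroup G,
      forall a v, G v -> G (skew_act iK (phi a) v)
    & forall v, G v -> G (frob k v)].

Definition fin_gen_AF_submodule (G : 'rV[K]_g -> Prop) : Prop :=
  is_AF_submodule G /\
  exists s : seq 'rV[K]_g,
    (forall v, v \in s -> G v) /\
    forall G', is_AF_submodule G' -> (forall v, v \in s -> G' v) ->
      forall v, G v -> G' v.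

End Submodules.

Section Points.

Variables (K L : fieldType) (iL : {rmorphism K -> L}) (g : nat).

(* X is the set of L-points, L = K^alg, of a closed subvariety of affine
   g-space defined over K. *)
Definition affine_subvariety (X : 'rV[L]_g -> Prop) : Prop :=
  exists S : seq {mpoly K[g]},
    forall v, X v <-> forall f, f \in S -> evalp iL (fun l => v 0 l) f = 0.

(* The image in L^g of a set of K-points, and the K-points of X. *)
Definition in_closure (G : 'rV[K]_g -> Prop) (v : 'rV[L]_g) : Prop :=
  exists2 u, G u & v = map_mx iL u.

Definition rational_points (X : 'rV[L]_g -> Prop) (u : 'rV[K]_g) : Prop :=
  X (map_mx iL u).

End Points.

Section FSets.

Variables (k : finFieldType) (L : fieldType) (g : nat).
Implicit Types C H G U : 'rV[L]_g -> Prop.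

Definition groupless_Fset C : Prop :=
  exists (m : nat) (b : 'rV[L]_g) (a : 'I_m -> 'rV[L]_g) (delta : 'I_m -> nat),
    (forall l, 0 < delta l)%N /\
    forall v, C v <-> exists e : 'I_m -> nat,
      v = b + \sum_(l < m) iter (delta l * e l) (@frob k L g) (a l).

Definition Fset_in G U : Prop :=
  exists C H,
    [/\ groupless_Fset C, forall v, C v -> G v,
        [/\ is_subgroup H, forall v, H v -> G v & forall v, H v -> H (frob k v)]
      & forall v, U v <-> exists c h, [/\ C c, H h & v = c + h]].

End FSets.

(* Main.v *)
(* Gamma is a finitely generated k[F]-module, so its elements are the values
   c_0 + F c_1 + F^2 c_2 + ... of finite words over a finite set of digits.  The
   sets { x in Gamma | c + F x in X }, iterated, are cut out by equations of
   bounded degree: expanding a coefficient in monomials times q-th powers halves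
   its degree.  So there are finitely many of them, and X is read off by a
   finite automaton.  All sets are defined by polynomials in a fixed
   finite-dimensional space; two subspaces of equal dimension, one inside the
   other, coincide, so a set S is contained in every closed set containing
   c + F^m S, as soon as c + F^m S is contained in S (frobenius_density).
   Hence, for a state q on a cycle, two paths of the same length inside the
   strongly connected component of q differ by an element of the stabilizer of
   the set X_q of q.  The stabilizer is closed and F^m-stable, so by regularity
   of K its equations can be taken over k, and it is F-stable.  Modulo the
   stabilizer the paths inside the component are the turns of one loop with
   value c, which sum to F^(Mn) a - a where F^M a - a = c; induction on the
   number of reachable states then gives F-sets with nested exponents
   n <= n + n_1, ..., and the density principle frees the exponents. *)

Require Import Defs.
From HB Require Import structures.
From mathcomp Require Import all_boot all_order all_algebra all_solvable all_field zify.
From mathcomp Require Import mpoly.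
From Stdlib Require Import Classical.

Set Implicit Arguments.
Unset Strict Implicit.
Unset Printing Implicit Defensive.

Import GRing.Theory.
Local Open Scope ring_scope.

(** * Powers of the Frobenius on rings and matrices *)

Section FrobeniusPower.
Variables (k : finFieldType) (R : comNzRingType) (i : {rmorphism k -> R}).

(** The additive group of [k] is an elementary abelian p-group, so [#|k|] is a power of p, and [i]
    transports the characteristic p to [R]. *)
Lemma pchar_nat_card m : [pchar R].-nat (#|k| ^ m)%N.
Proof.
have [p p_pr pchk] := finPcharP k.
have pcR : p \in [pchar R] by exact: (rmorph_pchar i).
have := abelem_pgroup (fin_ring_pchar_abelem pchk).
rewrite /pgroup cardsT => pk; rewrite pnatX; apply/orP; left.
apply: sub_in_pnat pk => l _ /eqP ->; exact: pcR.
Qed.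

(** The morphism argument records that [R] has the characteristic of [k]; with it in the term,
    [fpow i m] can carry the structure of a ring morphism. *)
Definition fpow (_ : {rmorphism k -> R}) (m : nat) (x : R) : R := x ^+ (#|k| ^ m).

Lemma fpow_is_zmod_morphism m : zmod_morphism (fpow i m).
Proof.
have fD x y : fpow i m (x + y) = fpow i m x + fpow i m y.
  exact: exprDn_pchar (pchar_nat_card m).
by move=> x y; apply: (addIr (fpow i m y)); rewrite -fD !subrK.
Qed.

Lemma fpow_is_monoid_morphism m : monoid_morphism (fpow i m).
Proof. by split=> [|x y]; rewrite /fpow ?expr1n ?exprMn. Qed.

HB.instance Definition _ m :=
  GRing.isZmodMorphism.Build R R (fpow i m) (fpow_is_zmod_morphism m).
HB.instance Definition _ m :=
  GRing.isMonoidMorphism.Build R R (fpow i m) (fpow_is_monoid_morphism m).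

Lemma fpow0 x : fpow i 0 x = x. Proof. by rewrite /fpow expn0 expr1. Qed.

Lemma fpowD m n x : fpow i (m + n) x = fpow i m (fpow i n x).
Proof. by rewrite /fpow -exprM -expnD addnC. Qed.

Lemma fpow_const m c : fpow i m (i c) = i c.
Proof.
rewrite /fpow -rmorphXn; congr (i _).
by elim: m => [|m IH]; rewrite ?expn0 ?expr1 // expnS exprM expf_card.
Qed.

Definition frobp m p n (A : 'M[R]_(p, n)) := map_mx (fpow i m) A.

Lemma frobp_is_zmod_morphism m p n : zmod_morphism (@frobp m p n).
Proof. by move=> A B; rewrite /frobp map_mxB. Qed.

HB.instance Definition _ m p n :=
  GRing.isZmodMorphism.Build 'M[R]_(p, n) 'M[R]_(p, n) (@frobp m p n)
    (@frobp_is_zmod_morphism m p n).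

Lemma frobp0 p n (A : 'M_(p, n)) : frobp 0 A = A.
Proof. by apply/matrixP=> a b; rewrite mxE fpow0. Qed.

Lemma frobpD m1 m2 p n (A : 'M_(p, n)) : frobp (m1 + m2) A = frobp m1 (frobp m2 A).
Proof. by apply/matrixP=> a b; rewrite !mxE fpowD. Qed.

Lemma frobpC m1 m2 p n (A : 'M_(p, n)) : frobp m1 (frobp m2 A) = frobp m2 (frobp m1 A).
Proof. by rewrite -!frobpD addnC. Qed.

End FrobeniusPower.

Lemma fpow_rmorph (k : finFieldType) (R S : comNzRingType) (iR : {rmorphism k -> R})
    (iS : {rmorphism k -> S}) (f : {rmorphism R -> S}) m x :
  f (fpow iR m x) = fpow iS m (f x).
Proof. by rewrite /fpow rmorphXn. Qed.

Lemma iter_frob (k : finFieldType) (L : fieldType) (i : {rmorphism k -> L})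
    (g m : nat) (v : 'rV[L]_g) : iter m (@frob k L g) v = frobp i m v.
Proof.
elim: m => [|m IH]; first by rewrite frobp0.
rewrite iterS IH -[m.+1]add1n frobpD.
by apply/matrixP=> a b; rewrite !mxE.
Qed.

(** * Closed sets of bounded degree as linear conditions on monomial vectors *)

Section SpanOfFamily.
Variables (F : fieldType) (N : nat).

(** Among matrices with all rows in [S], one of maximal rank spans [S]: a vector outside its row
    space could be added as a row and would raise the rank. *)
Lemma finite_span (S : 'rV[F]_N -> Prop) :
  exists n (A : 'M[F]_(n, N)),
    (forall a, S (row a A)) /\ forall v, S v -> (v <= A)%MS.
Proof.
pose good r := exists n (A : 'M[F]_(n, N)), (forall a, S (row a A)) /\ (r <= \rank A)%N.
have [r [gr rmax]] : exists r, good r /\ ~ good r.+1.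
  apply: NNPP => H.
  have gall r : good r.
    elim: r => [|r IH]; first by exists 0%N, 0; split=> // -[].
    by apply: NNPP => nr; apply: H; exists r.
  have [n [A [_]]] := gall N.+1; rewrite leqNgt ltnS; apply/negP; rewrite negbK.
  exact: rank_leq_col.
have [n [A [SA rA]]] := gr; exists n, A; split=> // v Sv.
case: (boolP (v <= A)%MS) => // nvA; case: rmax; exists (n + 1)%N, (col_mx A v); split.
  move=> a; case: (split_ordP a) => b ->; first by rewrite rowKu.
  by rewrite rowKd ord1 row_id.
apply: leq_ltn_trans rA _; rewrite -addsmxE; apply: rank_ltmx.
by rewrite ltmxE addsmxSl addsmx_sub submx_refl.
Qed.

End SpanOfFamily.

Section Monomials.
Variables (g d : nat).
Local Notation idx := {ffun 'I_g -> 'I_d}.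
Local Notation N := #|{: idx}|.

Section Def.
Variable R : comNzRingType.

(** Each exponent separately is bounded by [d]. This box of exponents is closed downwards, so
    translations of the variables act linearly on the vector of monomials. *)
Definition monomials (x : 'rV[R]_g) : 'rV[R]_N :=
  \row_j \prod_l x 0 l ^+ (enum_val j : idx) l.

Definition translation (c : 'rV[R]_g) : 'M[R]_N :=
  \matrix_(b, a) \prod_l (c 0 l ^+ ((enum_val a : idx) l - (enum_val b : idx) l)
                            *+ 'C((enum_val a : idx) l, (enum_val b : idx) l)).

Lemma monomials_add x c : monomials (c + x) = monomials x *m translation c.
Proof.
apply/rowP=> j; rewrite !mxE.
under [RHS]eq_bigr => b _ do rewrite !mxE -big_split /=.
rewrite (reindex (@enum_rank _)) /=; last first.
  by exists enum_val => ? _; rewrite (enum_rankK, enum_valK).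
under [RHS]eq_bigr => b _ do rewrite enum_rankK.
set al := (enum_val j : idx).
(* The sum over exponent vectors factors into one binomial expansion per coordinate; summands with
   [b > al l] vanish with their binomial coefficient. *)
rewrite -(bigA_distr_bigA (fun l (b : 'I_d) =>
   x 0 l ^+ b * (c 0 l ^+ (al l - b) *+ 'C(al l, b)))) /=.
apply: eq_bigr => l _; rewrite !mxE exprDn.
rewrite (big_ord_widen d (fun b => c 0 l ^+ (al l - b) * x 0 l ^+ b *+ 'C(al l, b))) ?ltn_ord //.
rewrite big_mkcond /=; apply: eq_bigr => b _.
case: ltnP => hb; last by rewrite bin_small // mulr0n mulr0.
by rewrite mulrnAr mulrC.
Qed.

End Def.

Lemma map_monomials (R S : comNzRingType) (f : {rmorphism R -> S}) x :
  map_mx f (monomials x) = monomials (map_mx f x).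
Proof.
apply/rowP=> j; rewrite !mxE rmorph_prod; apply: eq_bigr => l _.
by rewrite rmorphXn mxE.
Qed.

End Monomials.

Section ClosedSets.
Variables (k : finFieldType) (L : fieldType) (i : {rmorphism k -> L}) (g d : nat).
Local Notation N := #|{: {ffun 'I_g -> 'I_d}}|.
Implicit Types (S Z : 'rV[L]_g -> Prop).
Local Notation mon := (@monomials g d L).

(** [C] may be infinite, so arbitrary intersections of closed sets are closed without further
    argument. *)
Definition annihilated (C : 'cV[L]_N -> Prop) (x : 'rV[L]_g) : Prop :=
  forall c, C c -> mon x *m c = 0.

Definition is_closed Z : Prop := exists C, forall x, Z x <-> annihilated C x.

Lemma closed_translate Z c : is_closed Z -> is_closed (fun x => Z (c + x)).
Proof.
case=> C ZC; exists (fun b => exists2 a, C a & b = translation d c *m a) => x.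
rewrite ZC; split=> H => [_ [a Ca ->]|a Ca].
  by rewrite mulmxA -monomials_add H.
by rewrite monomials_add -mulmxA H //; exists a.
Qed.

(** The equations of every system that defines some [Z t] are pooled, which avoids choosing one
    system per [t]. *)
Lemma closed_forall (J : Type) (P : J -> Prop) (Z : J -> 'rV[L]_g -> Prop) :
  (forall t, P t -> is_closed (Z t)) -> is_closed (fun x => forall t, P t -> Z t x).
Proof.
move=> ZC; exists (fun b => exists t C, [/\ P t, forall x, Z t x <-> annihilated C x & C b]) => x.
split=> [H b [t [C [Pt hC Cb]]]|H t Pt].
  by have /hC := H t Pt; apply.
have [C hC] := ZC t Pt; apply/hC => b Cb; apply: H.
by exists t, C.
Qed.

(* [span (mon S)] contains its image under the affine map, and both have the
   same dimension, so they are equal. *)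
Lemma frobenius_density S Z c m :
  (forall x, S x -> S (c + frobp i m x)) -> is_closed Z ->
  (forall x, S x -> Z (c + frobp i m x)) -> forall x, S x -> Z x.
Proof.
move=> Sc [C ZC] SZ x Sx; apply/ZC => b Cb.
have [n [A [rowA spanA]]] := finite_span (fun v => exists2 y, S y & v = mon y).
pose B := map_mx (fpow i m) A *m translation d c.
have rowB a : exists2 y, S y & row a B = mon (c + frobp i m y).
  have [y Sy ey] := rowA a; exists y => //.
  by rewrite row_mul monomials_add -map_row ey map_monomials.
have BA : (B <= A)%MS.
  apply/row_subP => a; have [y Sy ->] := rowB a.
  by apply: spanA; exists (c + frobp i m y) => //; apply: Sc.
have rB : \rank A = \rank B.
  apply/eqP; rewrite eqn_leq (mxrankS BA) andbT.
  (* A field morphism preserves the rank, and translation by [- c] undoes translation by [c]; hence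
     [B] has at least the rank of [A]. *)
  have -> : \rank A = \rank (B *m translation d (- c)).
    rewrite -(mxrank_map (fpow i m) A); congr (\rank _).
    apply/row_matrixP => a; rewrite row_mul.
    have [y Sy ey] := rowA a.
    rewrite row_mul -!map_row ey map_monomials -!monomials_add.
    by rewrite addKr.
  exact: mxrankM_maxl.
have AB : (A <= B)%MS.
  by have := mxrank_leqif_sup BA; rewrite rB => /leqif_refl.
have B0 : B *m b = 0.
  apply/row_matrixP => a; rewrite row_mul row0; have [y Sy ->] := rowB a.
  by have /ZC := SZ y Sy; apply.
have /submxP[u ->] : (mon x <= B)%MS.
  by apply: submx_trans AB; apply: spanA; exists x.
by rewrite -mulmxA B0 mulmx0.
Qed.

End ClosedSets.

(** * Descent of Frobenius-stable subspaces to the constants *)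

Section Descent.
Variables (k : finFieldType) (K L : fieldType).
Variables (iK : {rmorphism k -> K}) (iL : {rmorphism K -> L}).

(** If [x] is algebraic and not in [k], then [1, x] are independent over [k], yet
    [x * 1 + (-1) * x = 0] is a relation with algebraic coefficients, against linear
    disjointness. *)
Lemma regular_constants : regular_extension iK iL ->
  forall x : K, algebraicOver iK x -> exists c, x = iK c.
Proof.
move=> regK x [p p0 px].
case: (classic (exists c, x = iK c)) => // nx.
pose y (l : 'I_2) : K := if l == 0 then 1 else x.
pose c (l : 'I_2) : L := if l == 0 then iL x else -1.
have /regK/(_ c) : lin_indep iK y.
  move=> a; rewrite !big_ord_recl big_ord0 /y /= mulr1 addr0 => ay l.
  have a1 : a 1 = 0.
    case: (eqVneq (a 1) 0) => // a1; case: nx.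
    have b1 : iK (a 1) != 0 by rewrite fmorph_eq0.
    exists (- (a 0 / a 1)); apply: (mulfI b1).
    rewrite rmorphN fmorph_div mulrN mulrCA divff // mulr1.
    apply/eqP; rewrite -addr_eq0 addrC -[X in _ == X]ay; apply/eqP.
    by congr (_ + iK (a _) * _); apply: val_inj.
  have a0 : a 0 = 0.
    apply: (fmorph_inj iK); rewrite rmorph0 -[RHS]ay.
    by rewrite (_ : lift _ _ = 1) ?a1 ?rmorph0 ?mul0r ?addr0 //; apply: val_inj.
  case: l => [[|[|l]] hl] //; first by rewrite -a0; congr a; apply: val_inj.
  by rewrite -[RHS]a1; congr a; apply: val_inj.
move=> H; have /H H1 : forall l, algebraicOver (fun a => iL (iK a)) (c l).
  move=> l; rewrite /c; case: (l == 0).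
    by exists p => //; rewrite (map_poly_comp iL iK) fmorph_root.
  exists ('X + 1%:P); first by rewrite -size_poly_gt0 size_XaddC.
  rewrite (map_poly_comp iL iK) !rmorphD /= !map_polyX !map_polyC /= !rmorph1.
  by rewrite /root !hornerE addNr.
have /H1/(_ 1)/eqP : \sum_(l < 2) c l * iL (y l) = 0.
  by rewrite !big_ord_recl big_ord0 /c /y /= rmorph1 mulr1 mulN1r addr0 subrr.
by rewrite /c oppr_eq0 oner_eq0.
Qed.

Hypothesis const : forall x : K, algebraicOver iK x -> exists c, x = iK c.

Lemma fpow_fixed_const m x : (0 < m)%N -> fpow iK m x = x -> exists c, x = iK c.
Proof.
move=> m0 xm; apply: const.
have q1 : (1 < #|k| ^ m)%N by rewrite -{1}(exp1n m) ltn_exp2r // finNzRing_gt1.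
exists ('X^(#|k| ^ m) - 'X).
  by rewrite -size_poly_eq0 size_polyDl ?size_polyXn // size_polyN size_polyX.
by rewrite rmorphB /= map_polyXn map_polyX /root !hornerE -/(fpow iK m x) xm subrr.
Qed.

(* A basis of the row space of [A] with an identity block in its pivot columns
   is determined by the row space, hence fixed by [fpow m]; its entries are then
   algebraic over [k], so they lie in [k]. *)
Lemma frobp_stable_span m n N (A : 'M[K]_(n, N)) : (0 < m)%N ->
  (frobp iK m A <= A)%MS -> (frobp iK 1 A <= A)%MS.
Proof.
move=> m0 mA; pose B0 := row_base A.
have fB0 : row_full B0^T by rewrite /row_full mxrank_tr; apply: row_base_free.
pose f := fullrankfun fB0; pose B1 := colsub f B0.
have uB1 : B1 \in unitmx.
  by rewrite -unitmx_tr /B1 trmx_mxsub; apply: fullrowsub_unit.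
pose B := invmx B1 *m B0.
have fB : colsub f B = 1%:M by rewrite /B -mulmx_colsub mulVmx.
have eqBA : (B :=: A)%MS.
  apply: eqmx_trans (eq_row_base A); apply: eqmxMfull.
  by rewrite row_full_unit unitmx_inv.
have /submxP[C1 eB] : (B <= A)%MS by rewrite eqBA.
have /submxP[C2 eA] : (A <= B)%MS by rewrite eqBA.
have /submxP[U eU] : (frobp iK m B <= B)%MS.
  rewrite eqBA; apply: submx_trans mA.
  by rewrite {1}eB /frobp map_mxM submxMl.
have U1 : U = 1%:M.
  have := congr1 (colsub f) eU; rewrite -mulmx_colsub fB mulmx1 => <-.
  by rewrite /frobp -map_mxsub fB map_mx1.
have B_fix : frobp iK 1 B = B.
  apply/matrixP=> a b; rewrite mxE.
  have [|c ->] := @fpow_fixed_const m (B a b) m0; last exact: fpow_const.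
  by have /matrixP/(_ a b) := eU; rewrite U1 mul1mx mxE.
by rewrite {1}eA /frobp map_mxM -/(frobp iK 1 B) B_fix -eqBA submxMl.
Qed.

Variables (g d : nat).

(** The monomial vectors of [H] span a [K]-space stable under [frobp m], hence under [frobp 1].
    Equations over [L] that vanish on [H] vanish on this span. *)
Lemma frobp_descent m (H : 'rV[K]_g -> Prop) Z : (0 < m)%N ->
  (forall x, H x -> H (frobp iK m x)) ->
  is_closed d Z -> (forall x, H x -> Z (map_mx iL x)) ->
  forall x, H x -> Z (map_mx iL (frobp iK 1 x)).
Proof.
move=> m0 Hm [C ZC] HZ x Hx; apply/ZC => b Cb.
have [n [A [rowA spanA]]] :=
  finite_span (fun v => exists2 y, H y & v = monomials d y).
have mA : (frobp iK m A <= A)%MS.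
  apply/row_subP => a; have [y Hy ey] := rowA a.
  rewrite /frobp -map_row ey map_monomials.
  by apply: spanA; exists (frobp iK m y) => //; apply: Hm.
have A0 : map_mx iL A *m b = 0.
  apply/row_matrixP => a; rewrite row_mul row0 -map_row.
  have [y Hy ->] := rowA a; rewrite map_monomials.
  by have /ZC := HZ y Hy; apply.
have /submxP[u eu] : (monomials d (frobp iK 1 x) <= A)%MS.
  apply: submx_trans (frobp_stable_span m0 mA).
  rewrite -map_monomials /frobp map_submx; apply: spanA; exists x => //.
by rewrite -map_monomials eu map_mxM -mulmxA A0 mulmx0.
Qed.

End Descent.

(** * Languages of automaton states and their stabilizers *)

Section Automaton.
Variables (k : finFieldType) (L : fieldType) (i : {rmorphism k -> L}) (g d : nat).
Local Notation V := 'rV[L]_g.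
Local Notation Fr m v := (frobp i m (v : V)).
Variables (G : V -> Prop) (D Q : finType) (dig : D -> V).
Variables (delta : Q -> D -> Q) (Z : Q -> V -> Prop).

Hypothesis closedL : GRing.closed_field_axiom L.
Hypothesis G_subgroup : is_subgroup G.
Hypothesis G_frob : forall v, G v -> G (Fr 1 v).
Hypothesis G_dig : forall c, G (dig c).

(** Horner evaluation with the lowest power of F first, so that reading a letter is the affine map
    through which [Z_delta] relates the sets of two states. *)
Fixpoint ev (w : seq D) : V := if w is c :: w' then dig c + Fr 1 (ev w') else 0.

Hypothesis G_ev : forall v, G v -> exists w, v = ev w.
Hypothesis Z_closed : forall q, is_closed d (Z q).
Hypothesis Z_delta : forall q c v, G v -> (Z (delta q c) v <-> Z q (dig c + Fr 1 v)).
Hypothesis descent : forall (H Y : V -> Prop) m, (0 < m)%N ->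
  (forall v, H v -> G v) -> (forall v, H v -> H (Fr m v)) -> is_closed d Y ->
  (forall v, H v -> Y v) -> forall v, H v -> Y (Fr 1 v).

Let G0 : G 0. Proof. by case: G_subgroup. Qed.
Let GB x y : G x -> G y -> G (x - y). Proof. by case: G_subgroup => _; apply. Qed.
Let GN x : G x -> G (- x). Proof. by rewrite -sub0r; apply: GB. Qed.
Let GD x y : G x -> G y -> G (x + y).
Proof. by move=> Gx Gy; rewrite -[y]opprK; apply/GB/GN. Qed.
Let GF m x : G x -> G (Fr m x).
Proof.
move=> Gx; elim: m => [|m IH]; first by rewrite frobp0.
by rewrite -add1n frobpD; apply: G_frob.
Qed.

Let FrD m (x y : V) : Fr m (x + y) = Fr m x + Fr m y. Proof. exact: raddfD. Qed.

Definition run q w := foldl delta q w.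

Lemma run_cat q w w' : run q (w ++ w') = run (run q w) w'.
Proof. exact: foldl_cat. Qed.

Lemma ev_in w : G (ev w).
Proof. by elim: w => //= c w IH; apply: GD; [apply: G_dig|apply: G_frob]. Qed.
Hint Resolve ev_in : core.

Lemma ev_cat w w' : ev (w ++ w') = ev w + Fr (size w) (ev w').
Proof.
elim: w => [|c w IH] /=; first by rewrite frobp0 add0r.
by rewrite IH FrD -frobpD add1n addrA.
Qed.

Definition language q v := G v /\ Z q v.

Lemma language_run q w v : G v -> language (run q w) v <-> language q (ev w + Fr (size w) v).
Proof.
elim: w q => [|c w IH] q Gv /=; first by rewrite frobp0 add0r.
have GFv : G (ev w + Fr (size w) v) by apply/GD/GF.
have -> : dig c + Fr 1 (ev w) + Fr (size w).+1 v
          = dig c + Fr 1 (ev w + Fr (size w) v).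
  by rewrite FrD addrA -frobpD add1n.
rewrite IH //= /language Z_delta //; split=> -[_ H]; split=> //.
by apply: GD => //; apply: GF.
Qed.

Definition reachable q q' := exists w, run q w = q'.
Definition on_cycle q := exists2 w, w != [::] & run q w = q.

Definition stab q v := G v /\ forall x, language q x -> language q (v + x).

(** [stab] only asks for an inclusion and is visibly a monoid; in characteristic p it is a group,
    because [- y] is the multiple [y *+ p.-1]. *)
Lemma stab_subgroup q : is_subgroup (stab q).
Proof.
have st0 : stab q 0 by split=> // x; rewrite add0r.
have stD x y : stab q x -> stab q y -> stab q (x + y).
  case=> Gx sx [Gy sy]; split; first exact: GD.
  by move=> z Xz; rewrite -addrA; apply/sx/sy.
split=> // x y sx sy; apply: (stD) => //.
have [p p_pr pchk] := finPcharP k.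
have pcL : p \in [pchar L] by exact: (rmorph_pchar i).
have -> : - y = y *+ p.-1.
  apply/rowP=> l; rewrite mulmxnE mxE; apply/eqP; rewrite eq_sym -addr_eq0.
  rewrite -mulrSr prednK ?prime_gt0 //.
  by rewrite -mulr_natr (pcharf0 pcL) mulr0.
by elim: p.-1 => [|n IH]; rewrite ?mulr0n // mulrS; apply: stD.
Qed.

(** Inside [G] the stabilizer is the intersection of the translates of [Z q] by the points of
    [language q]. *)
Lemma stab_closed q : exists2 Y, is_closed d Y &
  forall v, stab q v <-> G v /\ Y v.
Proof.
exists (fun v => forall x, language q x -> Z q (x + v)).
  by apply: closed_forall => x _; apply: closed_translate.
move=> v; split=> -[Gv H]; split=> // x Xx.
  by rewrite addrC; case: (H x Xx).
by split; [apply: GD => //; case: Xx|rewrite addrC; apply: H].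
Qed.

Lemma loop_stable q w x : run q w = q -> language q x -> language q (ev w + Fr (size w) x).
Proof. by move=> qw Xx; apply/language_run; rewrite ?qw //; case: Xx. Qed.

(** By [frobenius_density], a closed condition on [language q] need only be checked on its image
    under the affine map of a loop. *)
Lemma stab_of_loop q w v : run q w = q -> G v ->
  (forall x, language q x -> language q (v + (ev w + Fr (size w) x))) -> stab q v.
Proof.
move=> qw Gv H; split=> // x Xx; split; first by apply: GD => //; case: Xx.
apply: (@frobenius_density _ _ i _ d (language q) (fun x => Z q (v + x)) (ev w) (size w)) => //.
- by move=> y; apply: loop_stable.
- exact: closed_translate.
- by move=> y /H[].
Qed.

(** Close [u'] to a loop by a path back to [q]. Adding [ev u - ev u'] to a value read along this
    loop exchanges [u'] for [u], which gives a loop of the same length. *)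
Lemma stab_path_diff q q1 u u' : reachable q1 q -> run q u = q1 -> run q u' = q1 ->
  size u = size u' -> stab q (ev u - ev u').
Proof.
case=> v vq uq u'q su; apply: (@stab_of_loop q (u' ++ v)).
- by rewrite run_cat u'q.
- exact: GB.
move=> x Xx; rewrite ev_cat addrA addrA subrK size_cat -su -size_cat -ev_cat.
by apply: loop_stable; rewrite // run_cat uq.
Qed.

(** With m the length of a loop, F^m-stability comes from [stab_of_loop], since the affine map of
    the loop turns translation by [v] into translation by F^m [v]; [descent] replaces F^m by F. *)
Lemma stab_frob q v : on_cycle q -> stab q v -> stab q (Fr 1 v).
Proof.
case=> w w0 qw sv; have [Y Yc sY] := stab_closed q.
apply/sY; split; first by apply: GF; case: sv.
apply: (@descent (stab q) Y (size w)) => //; first by rewrite lt0n size_eq0.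
- by move=> ? [].
- move=> {sv}v [Gv sv]; apply: (@stab_of_loop q w) => //; first exact: GF.
  move=> x Xx; rewrite addrCA -FrD; apply: loop_stable => //.
  exact: sv.
- by move=> ? /sY[].
Qed.


Lemma artin_schreier m (v : V) : (0 < m)%N -> exists a : V, Fr m a - a = v.
Proof.
move=> m0; have q1 : (1 < #|k| ^ m)%N.
  by rewrite -{1}(exp1n m) ltn_exp2r // finNzRing_gt1.
have sol (l : 'I_g) : exists x, fpow i m x = v 0 l + x.
  (* Coefficients of the equation x^(q^m) = v + x: constant term [v 0 l], linear term 1, all others
     0. *)
  pose P j : L := if j is j'.+1 then (j' == 0%N)%:R else v 0 l.
  have [x xP] := closedL P (ltnW q1); exists x.
  rewrite /fpow xP; case: (#|k| ^ m)%N q1 => [|[|n]] // _.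
  rewrite !big_ord_recl big1 ?addr0 => [|j _]; last by rewrite mul0r.
  by rewrite mulr1 mul1r expr1.
have [x xP] := fin_all_exists sol; exists (\row_l x l).
by apply/rowP=> l; rewrite !mxE xP addrK.
Qed.

Lemma common_loop_length : exists2 M, (0 < M)%N &
  forall q, on_cycle q -> exists2 w, size w = M & run q w = q.
Proof.
have loop q : exists n, (0 < n)%N /\
    (on_cycle q -> exists2 w, size w = n & run q w = q).
  case: (classic (on_cycle q)) => [[w w0 qw]|nq]; last by exists 1%N.
  by exists (size w); rewrite lt0n size_eq0 w0; split=> // _; exists w.
(* The common length is a product of individual loop lengths, so each loop is repeated as often as
   the other factors require; states off cycles contribute the factor 1. *)
have [f fP] := fin_all_exists loop; exists (\prod_q f q).
  by apply: prodn_gt0 => q; case: (fP q).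
move=> q; have [_ fq] := fP q => /fq[w sw qw].
exists (flatten (nseq (\prod_(q' | q' != q) f q') w)).
  by rewrite size_flatten /shape map_nseq sumn_nseq sw [RHS](bigD1 q).
by elim: (\prod_(_ | _) _)%N => //= n IH; rewrite run_cat qw.
Qed.

(** * Covers by translates of orbit sums *)

Variable M : nat.
Hypothesis M_gt0 : (0 < M)%N.
Hypothesis M_loop : forall q, on_cycle q -> exists2 w, size w = M & run q w = q.

Definition orbit_sum m (a : 'I_m -> V) (e : 'I_m -> nat) : V :=
  \sum_l Fr (M * e l) (a l).

(** An F-set whose steps all equal [M]. Only the points [b + orbit_sum a e] must lie in [G]; [b] and
    the [a l] may lie outside, as solutions from [artin_schreier] do. *)
Definition good (U : V -> Prop) : Prop :=
  exists m (b : V) (a : 'I_m -> V) (H : V -> Prop),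
    [/\ forall e, G (b + orbit_sum a e), is_subgroup H, forall v, H v -> G v,
        forall v, H v -> H (Fr 1 v)
      & forall v, U v <-> exists e h, H h /\ v = b + orbit_sum a e + h].

(* The good sets are required to lie inside the larger set [B], so that covers
   of the pieces of [B] can be put together. *)
Definition cover (A B : V -> Prop) : Prop :=
  exists (I : finType) (U : I -> V -> Prop),
    [/\ forall t, good (U t), forall t v, U t v -> B v
      & forall v, A v -> exists t, U t v].

Lemma cover_union (J : finType) (A : J -> V -> Prop) (B : V -> Prop) :
  (forall j, cover (A j) B) -> cover (fun v => exists j, A j v) B.
Proof.
case/fin_all_exists => I /fin_all_exists[U UP].
exists {j : J & I j}, (fun t => U (tag t) (tagged t)); split.
- by case=> j t; have [gU _ _] := UP j; apply: gU.
- by case=> j t v; have [_ UB _] := UP j; apply: UB.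
- by move=> v [j Av]; have [_ _ /(_ v Av)[t Ut]] := UP j; exists (Tagged I t).
Qed.

Lemma cover_empty A B : (forall v, ~ A v) -> cover A B.
Proof. by move=> A0; exists 'I_0, (fun _ _ => False); split=> [[]|[]|v /A0]. Qed.

Lemma cover_sub A A' B : (forall v, A v -> A' v) -> cover A' B -> cover A B.
Proof. by move=> AA' [I [U [gU UB cU]]]; exists I, U; split=> // v /AA'; apply: cU. Qed.

(** [R x v] means that [v] arises from [x]. A cover is transported piece by piece once each good set
    is sent into one good set that receives all the points arising from it. *)
Lemma cover_map (A A' B B' : V -> Prop) (R : V -> V -> Prop) :
  (forall U, good U -> (forall v, U v -> B v) -> exists U', [/\ good U',
     forall v, U' v -> B' v & forall x v, U x -> R x v -> U' v]) ->
  (forall v, A' v -> exists2 x, A x & R x v) -> cover A B -> cover A' B'.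
Proof.
move=> HU HA [I [U [gU UB cU]]].
have /fin_all_exists[U' U'P] t := HU _ (gU t) (UB t).
exists I, U'; split=> [t|t|v /HA[x Ax Rxv]]; [by case: (U'P t)..|].
by have [t Ut] := cU _ Ax; exists t; have [_ _ H] := U'P t; apply: (H x).
Qed.

Lemma subgroup_frob (H : V -> Prop) m v :
  (forall v, H v -> H (Fr 1 v)) -> H v -> H (Fr m v).
Proof.
move=> HF Hv; elim: m => [|m IH]; first by rewrite frobp0.
by rewrite -add1n frobpD; apply: HF.
Qed.

Lemma frobp_orbit_sum n m (a : 'I_m -> V) e :
  Fr n (orbit_sum a e) = orbit_sum (fun l => Fr n (a l)) e.
Proof. by rewrite /orbit_sum raddf_sum; apply: eq_bigr => l _ /=; rewrite frobpC. Qed.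

Lemma frobp_shift_orbit_sum n m (a : 'I_m -> V) e :
  Fr (M * n) (orbit_sum a e) = orbit_sum a (fun l => n + e l)%N.
Proof.
rewrite /orbit_sum raddf_sum; apply: eq_bigr => l _ /=.
by rewrite -frobpD mulnDr.
Qed.

Lemma cover_zero q : language q 0 -> cover (fun v => v = 0) (language q).
Proof.
move=> X0; exists unit, (fun _ v => v = 0); split=> [_|_ v ->|v] //.
exists 0%N, 0, (fun=> 0), (fun v => v = 0); split.
- by move=> e; rewrite /orbit_sum big_ord0 addr0.
- by split=> // x y -> ->; rewrite subr0.
- by move=> v ->.
- by move=> v ->; rewrite raddf0.
move=> v; rewrite /orbit_sum; split=> [->|[e [h [->]]]].
  by exists (fun=> 0%N), 0; rewrite big_ord0 !addr0.
by rewrite big_ord0 !addr0.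
Qed.

Lemma image_subgroup (H : V -> Prop) n :
  is_subgroup H -> (forall v, H v -> G v) -> (forall v, H v -> H (Fr 1 v)) ->
  let H' v := exists2 h, H h & v = Fr n h in
  [/\ is_subgroup H', forall v, H' v -> G v & forall v, H' v -> H' (Fr 1 v)].
Proof.
move=> [H0 HB] HG HF H'; split.
- split; first by exists 0; rewrite ?raddf0.
  move=> x y [x' Hx ->] [y' Hy ->]; exists (x' - y'); first exact: HB.
  by rewrite raddfB.
- by move=> v [h /HG Gh ->]; apply: GF.
- by move=> v [h /HF Hh ->]; exists (Fr 1 h); rewrite // frobpC.
Qed.

Lemma sum_subgroup (H1 H2 : V -> Prop) :
  is_subgroup H1 -> (forall v, H1 v -> G v) -> (forall v, H1 v -> H1 (Fr 1 v)) ->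
  is_subgroup H2 -> (forall v, H2 v -> G v) -> (forall v, H2 v -> H2 (Fr 1 v)) ->
  let H' v := exists h1 h2, [/\ H1 h1, H2 h2 & v = h1 + h2] in
  [/\ is_subgroup H', forall v, H' v -> G v & forall v, H' v -> H' (Fr 1 v)].
Proof.
move=> [H10 H1B] H1G H1F [H20 H2B] H2G H2F H'; split.
- split; first by exists 0, 0; rewrite addr0.
  move=> x y [x1 [x2 [? ? ->]]] [y1 [y2 [? ? ->]]].
  by exists (x1 - y1), (x2 - y2); split; [apply: H1B|apply: H2B|rewrite opprD addrACA].
- by move=> v [x [y [/H1G Gx /H2G Gy ->]]]; apply: GD.
- move=> v [x [y [/H1F Hx /H2F Hy ->]]]; exists (Fr 1 x), (Fr 1 y).
  by rewrite FrD.
Qed.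

Lemma cover_step q c T : cover T (language (delta q c)) ->
  cover (fun v => exists2 x, T x & v = dig c + Fr 1 x) (language q).
Proof.
apply: (cover_map (R := fun x v => v = dig c + Fr 1 x)) => //.
move=> U [m [b [a [H [Gb Hs HG HF UP]]]]] UX.
have [H's H'G H'F] := image_subgroup 1 Hs HG HF.
exists (fun v => exists2 x, U x & v = dig c + Fr 1 x); split.
- exists m, (dig c + Fr 1 b), (fun l => Fr 1 (a l)), (fun v => exists2 h, H h & v = Fr 1 h).
  split=> // [e|v].
    by rewrite -frobp_orbit_sum -addrA -FrD; apply/GD/GF.
  split=> [[x /UP[e [h [Hh ->]]] ->]|[e [_ [[h Hh ->] ->]]]].
    exists e, (Fr 1 h); split; first by exists h.
    by rewrite -frobp_orbit_sum !FrD !addrA.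
  exists (b + orbit_sum a e + h); first by apply/UP; exists e, h.
  by rewrite !FrD frobp_orbit_sum !addrA.
- by move=> v [x /UX[Gx Zx] ->]; split; [apply/GD/GF|apply/Z_delta].
- by move=> x v Ux ->; exists x.
Qed.

Lemma run_loop q c n : run q c = q -> run q (flatten (nseq n c)) = q.
Proof. by move=> qc; elim: n => //= n IH; rewrite run_cat qc. Qed.

Lemma size_loop (c : seq D) n : size (flatten (nseq n c)) = (size c * n)%N.
Proof. by rewrite size_flatten /shape map_nseq sumn_nseq. Qed.

(** The geometric sum of the turns telescopes once [ev c] is written as [Fr (size c) a - a]. *)
Lemma ev_loop c a n : Fr (size c) a - a = ev c ->
  ev (flatten (nseq n c)) = Fr (size c * n) a - a.
Proof.
move=> ea; elim: n => [|n IH] /=; first by rewrite muln0 frobp0 subrr.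
by rewrite ev_cat IH -ea raddfB /= -frobpD -mulnS addrC -addrA addKr.
Qed.

Definition ocons m (b : V) (a : 'I_m -> V) (l : 'I_m.+1) : V :=
  if unlift ord0 l is Some l' then a l' else b.

Lemma orbit_sum_cons m (b : V) (a : 'I_m -> V) e :
  orbit_sum (ocons b a) e
  = Fr (M * e ord0) b + orbit_sum a (fun l => e (lift ord0 l)).
Proof.
rewrite /orbit_sum big_ord_recl /ocons unlift_none; congr (_ + _).
by apply: eq_bigr => l _; rewrite liftK.
Qed.

(** * Turns of a loop and the freeing of nested exponents *)

Section Loop.
Variables (q q1 : Q) (c u0 : seq D) (a0 : V).
Hypotheses (c_size : size c = M) (qc : run q c = q) (qu0 : run q u0 = q1).
Hypothesis a0P : Fr M a0 - a0 = ev c.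

Lemma ev_spiral n :
  ev (flatten (nseq n c) ++ u0) = - a0 + Fr (M * n) (a0 + ev u0).
Proof.
have := @ev_loop c a0 n; rewrite c_size => /(_ a0P) eqc.
by rewrite ev_cat eqc size_loop c_size FrD addrA [- a0 + _]addrC.
Qed.

Lemma run_spiral n : run q (flatten (nseq n c) ++ u0) = q1.
Proof. by rewrite run_cat run_loop. Qed.

(** After [n] turns of [c] and the path [u0], a point of [U] has exponents [n] and [n + e l]. The
    good set [U'] lets these vary independently, has base point [- a0], new generator [b1] and group
    [stab q] + F^s0 [H]. *)
Lemma good_loop U : good U -> (forall v, U v -> language q1 v) ->
  exists U', [/\ good U', forall v, U' v -> language q v
    & forall n h x, stab q h -> U x ->
      U' (h + ev (flatten (nseq n c) ++ u0) + Fr (M * n + size u0) x)].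
Proof.
move=> [m [b [a [H [Gb Hs HG HF UP]]]]] UX.
pose s0 := size u0; pose b1 := a0 + ev u0 + Fr s0 b.
pose a1 l := Fr s0 (a l).
have FH n h : H h -> H (Fr n h) by apply: subgroup_frob.
have eq_spiral n x : ev (flatten (nseq n c) ++ u0) + Fr (M * n + s0) (b + x)
                   = - a0 + Fr (M * n) (b1 + Fr s0 x).
  by rewrite ev_spiral (frobpD _ (M * n)) /b1 !FrD !addrA.
have spiral n e h : H h ->
    language q (- a0 + Fr (M * n) b1 + Fr (M * n) (Fr s0 (orbit_sum a e + h))).
  move=> Hh; have Ux : U (b + orbit_sum a e + h) by apply/UP; exists e, h.
  have /UX XU := Ux; rewrite -addrA -FrD -eq_spiral (addrA b).
  have <- : size (flatten (nseq n c) ++ u0) = (M * n + s0)%N.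
    by rewrite size_cat size_loop c_size.
  by apply/language_run; [case: XU|rewrite run_spiral].
have [H's H'G H'F] := image_subgroup s0 Hs HG HF.
have H0 : H 0 by case: Hs.
(* This frees the exponents: the set of all [Fr s0 (orbit_sum a e + h)] is stable under F^(Mn), so a
   closed condition that holds on its image under F^(Mn) holds on all of it. *)
have dense n e h : H h ->
    language q (- a0 + Fr (M * n) b1 + Fr s0 (orbit_sum a e + h)).
  move=> Hh; split.
    (* Membership in [G] follows by comparison with the spiral point for [e = 0], [h = 0]:
       differences of orbit sums are differences of points [b + orbit_sum a e] of [G]. *)
    have [Gn _] := spiral n (fun=> 0%N) 0 H0.
    rewrite -[Fr s0 _](subrK (Fr (M * n) (Fr s0 (orbit_sum a (fun=> 0%N) + 0)))).
    rewrite addrCA; apply: GD => //; rewrite frobpC -raddfB; apply: GF.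
    rewrite addr0 frobp_shift_orbit_sum addrAC; apply: GD; last exact: HG.
    set e' := (fun _ => _).
    by have := GB (Gb e) (Gb e'); rewrite opprD addrACA subrr add0r.
  apply: (@frobenius_density _ _ i _ d
    (fun y => exists e h, H h /\ y = Fr s0 (orbit_sum a e + h))
    (fun y => Z q (- a0 + Fr (M * n) b1 + y)) 0 (M * n)).
  - move=> _ [{}e [{Hh}h [Hh ->]]]; exists (fun l => n + e l)%N, (Fr (M * n) h).
    by rewrite -frobp_shift_orbit_sum -FrD add0r frobpC; split=> //; apply: FH.
  - exact: closed_translate.
  - by move=> _ [{}e [{Hh}h [Hh ->]]]; rewrite add0r; case: (spiral n e h Hh).
  - by exists e, h.
have q_cycle : on_cycle q.
  by exists c => //; rewrite -size_eq0 c_size -lt0n.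
have stG v : stab q v -> G v by case.
have [Ks KG KF] := sum_subgroup (stab_subgroup q) stG
  (fun v => @stab_frob q v q_cycle) H's H'G H'F.
have a1E e : orbit_sum a1 e = Fr s0 (orbit_sum a e) by rewrite frobp_orbit_sum.
exists (fun v => exists e h', (exists h1 h2, [/\ stab q h1,
    exists2 h, H h & h2 = Fr s0 h & h' = h1 + h2])
  /\ v = - a0 + orbit_sum (ocons b1 a1) e + h'); split.
- exists m.+1, (- a0), (ocons b1 a1), (fun v => exists h1 h2, [/\ stab q h1,
    exists2 h, H h & h2 = Fr s0 h & v = h1 + h2]); split=> // e.
  rewrite orbit_sum_cons a1E addrA.
  by have [] := dense (e ord0) (fun l => e (lift ord0 l)) 0 H0; rewrite addr0.
- move=> v [e [_ [[h1 [_ [[_ h1P] [h Hh ->] ->]]] ->]]].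
  rewrite orbit_sum_cons a1E addrCA; apply: h1P.
  by rewrite addrA -addrA -FrD; apply: dense.
move=> n h x hP /UP[e [h2 [Hh2 ->]]].
(* The nested exponents of the given path are one particular choice among the free ones. *)
pose e' (l : 'I_m.+1) : nat := if unlift ord0 l is Some l' then (n + e l')%N else n.
exists e', (h + Fr s0 (Fr (M * n) h2)); split.
  by exists h, (Fr s0 (Fr (M * n) h2)); split=> //; exists (Fr (M * n) h2); auto.
rewrite -addrA -[_ + _ + h2]addrA eq_spiral orbit_sum_cons a1E /e' unlift_none.
have -> : orbit_sum a (fun l => if unlift ord0 (lift ord0 l) is Some l'
    then (n + e l')%N else n) = Fr (M * n) (orbit_sum a e).
  by rewrite frobp_shift_orbit_sum; apply: eq_bigr => l _; rewrite liftK.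
rewrite [RHS]addrCA; congr (_ + _).
by rewrite /b1 !FrD !(frobpC _ (M * n) s0) !addrA.
Qed.

End Loop.

Lemma exists_minimal (P : nat -> Prop) : (exists n, P n) ->
  exists n, P n /\ forall n', P n' -> (n <= n')%N.
Proof.
case=> n; elim/ltn_ind: n => n IH Pn.
case: (classic (exists n', P n' /\ (n' < n)%N)) => [[n' [Pn' ltn']]|min_n].
  exact: IH ltn' Pn'.
exists n; split=> // n' Pn'; rewrite leqNgt; apply/negP => ltn'.
by apply: min_n; exists n'.
Qed.

(* For each residue class of the length modulo [M], the paths from [q] to [q1]
   are, modulo [stab q], one shortest path preceded by turns of a loop at [q]. *)
Lemma cover_loop q q1 T : on_cycle q -> reachable q1 q -> cover T (language q1) ->
  cover (fun v => exists u x, [/\ run q u = q1, T x & v = ev u + Fr (size u) x]) (language q).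
Proof.
move=> q_cycle q1q covT; have [c c_size qc] := M_loop q_cycle.
have [a0 a0P] := artin_schreier (ev c) M_gt0.
pose P (s : 'I_M) v := exists u x, [/\ run q u = q1, T x, (size u %% M = s)%N
  & v = ev u + Fr (size u) x].
apply: (@cover_sub _ (fun v => exists s, P s v)).
  move=> v [u [x [qu Tx ->]]]; exists (Ordinal (ltn_pmod (size u) M_gt0)).
  by exists u, x.
apply: cover_union => s.
case: (classic (exists n u, [/\ size u = n, run q u = q1 & (n %% M = s)%N])); last first.
  move=> nP; apply: cover_empty => v [u [x [qu _ us _]]].
  by case: nP; exists (size u), u.
case/exists_minimal => n0 [[u0 [<- qu0 u0s]] u0_min].
apply: (cover_map (R := fun x v => exists n h, stab q h /\
  v = h + ev (flatten (nseq n c) ++ u0) + Fr (M * n + size u0) x)) covT.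
  move=> U gU UX; have [U' [gU' U'X HU']] := good_loop c_size qc qu0 a0P gU UX.
  by exists U'; split=> // x v Ux [n [h [hP ->]]]; apply: HU'.
move=> v [u [x [qu Tx us ->]]]; exists x => //.
have le_u : (size u0 <= size u)%N by apply: u0_min; exists u.
have /dvdnP[n en] : (M %| size u - size u0)%N by rewrite -eqn_mod_dvd // us u0s.
have su : size u = (M * n + size u0)%N by rewrite mulnC -en subnK.
exists n, (ev u - ev (flatten (nseq n c) ++ u0)); rewrite subrK -su; split=> //.
apply: (stab_path_diff q1q) => //; first by rewrite run_cat run_loop.
by rewrite size_cat size_loop c_size.
Qed.

(** * Leaving a strongly connected component *)

Definition edge : rel Q := fun q q' => [exists c, delta q c == q'].

Lemma connect_run q w : connect edge q (run q w).
Proof.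
elim: w q => [|c w IH] q /=; first exact: connect0.
apply: connect_trans (IH _); apply: connect1.
by apply/existsP; exists c.
Qed.

Lemma connect_reachable q q' : connect edge q q' -> reachable q q'.
Proof.
case/connectP => p; elim: p q => [|q1 p IH] q /= => [_ ->|/andP[/existsP[c /eqP <-] pp] lp].
  by exists [::].
by have [w <-] := IH _ pp lp; exists (c :: w).
Qed.

(** Follow [w] while [q] remains reachable: either the word ends first, with remainder 0, or some
    letter [c] is the first after which [q] cannot be reached again. *)
Lemma leave_component q w q1 : connect edge q1 q -> language q1 (ev w) ->
  exists u q2, [/\ run q1 u = q2, connect edge q2 q &
    (language q2 0 /\ ev w = ev u + Fr (size u) 0) \/
    exists c x, [/\ ~~ connect edge (delta q2 c) q, language (delta q2 c) x
      & ev w = ev u + Fr (size u) (dig c + Fr 1 x)]].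
Proof.
elim: w q1 => [|c w IH] q1 q1q Xw.
  by exists [::], q1; split=> //; left; rewrite /= raddf0 addr0.
have Xw' : language (delta q1 c) (ev w) by case: Xw => _ Zw; split=> //; apply/Z_delta.
case: (boolP (connect edge (delta q1 c) q)) => [cq|ncq].
  have [u [q2 [uq2 q2q H]]] := IH _ cq Xw'.
  exists (c :: u), q2; split=> //=; case: H => [[X0 ->]|[c' [x [ncx Xx ->]]]]; [left|right].
    by split; rewrite //= !raddf0 !addr0.
  by exists c', x; split; rewrite //= [in LHS]FrD -frobpD add1n addrA.
exists [::], q1; split=> //; right; exists c, (ev w); split=> //=.
by rewrite frobp0 add0r.
Qed.

Lemma cover_state q : cover (language q) (language q).
Proof.
have [n] := ubnP #|connect edge q|; elim: n q => // n IH q; rewrite ltnS => le_n.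
(* [None] stands for a word that ends at [q2], [Some c] for one that leaves the component there by
   the letter [c]. *)
pose exit_set q2 (o : option D) v : Prop :=
  if o is Some c then ~~ connect edge (delta q2 c) q /\
    exists2 x, language (delta q2 c) x & v = dig c + Fr 1 x
  else language q2 0 /\ v = 0.
have cov_exit q2 o : connect edge q q2 -> cover (exit_set q2 o) (language q2).
  move=> qq2; case: o => [c|] /=; last first.
    case: (classic (language q2 0)) => [X0|nX0]; last by apply: cover_empty => v [].
    by apply: cover_sub (cover_zero X0) => v [].
  case: (boolP (connect edge (delta q2 c) q)) => [cq|ncq].
    by apply: cover_empty => v [/negP nc _]; apply: nc.
  have /cover_step covc : cover (language (delta q2 c)) (language (delta q2 c)).
    (* Every state reachable after the exit was reachable from [q], but [q] itself no longer is, so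
       the count drops strictly. *)
    apply: IH; apply: leq_trans le_n; apply: proper_card; apply/properP; split.
      apply/subsetP => q3; rewrite !unfold_in => cq3.
      exact: connect_trans qq2 (connect_trans (connect_run q2 [:: c]) cq3).
    by exists q; [exact: connect0|exact: ncq].
  by apply: cover_sub covc => v [].
pose P (j : Q * option D) v := connect edge j.1 q /\
  exists u x, [/\ run q u = j.1, exit_set j.1 j.2 x & v = ev u + Fr (size u) x].
apply: (@cover_sub _ (fun v => exists j, P j v)).
  move=> v Xv; have [w ew] := G_ev (proj1 Xv); subst v.
  have [u [q2 [uq2 q2q [[X0 eu]|[c [x [ncx Xx eu]]]]]]] := leave_component (connect0 _ q) Xv.
    by exists (q2, None); split=> //; exists u, 0.
  exists (q2, Some c); split=> //; exists u, (dig c + Fr 1 x); split=> //=.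
  by split=> //; exists x.
apply: cover_union => -[q2 o] /=.
case: (classic (connect edge q2 q /\ reachable q q2)); last first.
  by move=> nH; apply: cover_empty => v [q2q [u [x [uq2 _ _]]]]; case: nH; split=> //; exists u.
case=> q2q [u0 u0q2].
have qq2 : connect edge q q2 by rewrite -u0q2 connect_run.
case: (classic (on_cycle q)) => [q_cycle|nq].
  apply: cover_sub (cover_loop q_cycle (connect_reachable q2q) (cov_exit _ o qq2)) => v.
  by case.
(* If [q] lies on no cycle, its component contains only the empty path, and the exit sets at [q]
   suffice. *)
have nil_loop u : run q u = q2 -> u = [::].
  move=> uq2; have [v vq] := connect_reachable q2q.
  case: u uq2 => // c u uq2; case: nq; exists (c :: u ++ v) => //.
  by rewrite -cat_cons run_cat uq2.
have eq2 : q2 = q by rewrite -u0q2 (nil_loop _ u0q2).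
apply: cover_sub (cov_exit q o (connect0 _ q)) => v [_ [u [x [/= uq2 ex ->]]]].
by rewrite (nil_loop _ uq2) /= add0r frobp0 -eq2.
Qed.

End Automaton.

(** * Extraction of q-th roots from equations, and the finite automaton *)

(** The vectors [v] with [\sum_l y l * v_l^q = 0] form a [K]-subspace, since scalars leave the sum
    as q-th powers. Linear equations for the span of its points coming from [R] replace the
    condition; an adjugate clears their denominators. *)
Lemma frobenius_relations (k : finFieldType) (K : fieldType) (iK : {rmorphism k -> K})
    (R : comNzRingType) (theta : {rmorphism R -> K}) n (y : 'I_n -> K) :
  exists C : 'M[R]_n, forall z : 'rV[R]_n,
    \sum_l y l * fpow iK 1 (theta (z 0 l)) = 0 <-> map_mx theta (z *m C) = 0.
Proof.
pose rel (v : 'rV[K]_n) := \sum_l y l * fpow iK 1 (v 0 l) = 0.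
have [m [A [rowA spanA]]] :=
  finite_span (fun v => rel v /\ exists z, v = map_mx theta z).
have rel_span (v : 'rV_n) : (v <= A)%MS -> rel v.
  case/submxP => u ->; rewrite /rel.
  under eq_bigr => l _ do rewrite mxE rmorph_sum mulr_sumr.
  rewrite exchange_big big1 // => a _ /=.
  under eq_bigr => l _ do rewrite rmorphM mulrCA.
  rewrite -mulr_sumr; have [ra _] := rowA a.
  by move: ra; rewrite /rel; under eq_bigr => l _ do rewrite mxE; move=> ->; rewrite mulr0.
have [z zP] := fin_all_exists (fun a => proj2 (rowA a)).
pose At : 'M[R]_(m, n) := \matrix_(a, l) z a 0 l.
have AtA : map_mx theta At = A.
  by apply/matrixP => a l; have /rowP/(_ l) := zP a; rewrite !mxE => ->.
pose A1 := rowsub (maxrankfun A) A.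
have A1_full : row_full A1^T by rewrite /row_full mxrank_tr; apply: maxrowsub_free.
pose f := fullrankfun A1_full; pose B := colsub f A1.
have uB : B \in unitmx.
  by rewrite -unitmx_tr /B trmx_mxsub; apply: fullrowsub_unit.
pose A1t := rowsub (maxrankfun A) At; pose Bt := colsub f A1t.
have A1tE : map_mx theta A1t = A1 by rewrite map_mxsub AtA.
have BtE : map_mx theta Bt = B by rewrite map_mxsub A1tE.
(* With [v_f] the pivot columns of [v], the vector [v] lies in the row space of [A1] exactly when
   [\det B *: v = v_f *m (\adj B *m A1)]; this matrix lifts the condition to [R]. *)
exists ((\det Bt)%:M - colsub f 1%:M *m (\adj Bt *m A1t)) => x.
set v := map_mx theta x.
have -> : map_mx theta (x *m ((\det Bt)%:M - colsub f 1%:M *m (\adj Bt *m A1t)))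
        = \det B *: v - colsub f v *m (\adj B *m A1).
  rewrite mulmxBr map_mxB mul_mx_scalar map_mxZ -det_map_mx BtE; congr (_ - _).
  rewrite mulmxA mulmx_colsub mulmx1 !map_mxM map_mxsub map_mx_adj BtE.
  by rewrite A1tE.
have -> : \sum_l y l * fpow iK 1 (theta (x 0 l)) = \sum_l y l * fpow iK 1 (v 0 l).
  by apply: eq_bigr => l _; rewrite mxE.
have A1A : (A1 :=: A)%MS := eq_maxrowsub A.
split=> [rv|/eqP].
  have /submxP[u eu] : (v <= A1)%MS by rewrite A1A; apply: spanA; split=> //; exists x.
  rewrite eu -mulmx_colsub -/B -mulmxA [B *m _]mulmxA mul_mx_adj mul_scalar_mx.
  by rewrite -scalemxAr subrr.
rewrite subr_eq0 => /eqP ev; apply: rel_span; rewrite -A1A.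
have detB : \det B != 0 by rewrite -unitfE.
by rewrite -[v](scalerK detB) ev scalemx_sub // mulmxA submxMl.
Qed.

Section FrobeniusComponents.
Variables (k : finFieldType) (s : nat).
Local Notation R := {mpoly k[s]}.
Local Notation q := #|k|.
Local Notation idx := {ffun 'I_s -> 'I_q}.

Lemma card_gt1 : (1 < q)%N. Proof. exact: finNzRing_gt1. Qed.

Definition residue (m : 'X_{1..s}) : idx :=
  [ffun l => Ordinal (ltn_pmod (m l) (ltnW card_gt1))].
Definition quotient_mnm (m : 'X_{1..s}) : 'X_{1..s} := [multinom (m l %/ q)%N | l < s].
Definition residue_mnm (r : idx) : 'X_{1..s} := [multinom (r l : nat) | l < s].

(** The polynomial ring is free over its subring of q-th powers, with basis the monomials of
    exponents below q; this is the q-th root of the coordinate at [r]. *)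
Definition component (r : idx) (P : R) : R :=
  \sum_(m <- msupp P | residue m == r) P@_m *: 'X_[quotient_mnm m].

Lemma component_decomposition P :
  P = \sum_r 'X_[residue_mnm r] * fpow (@mpolyC s k) 1 (component r P).
Proof.
rewrite {1}[P]mpolyE (partition_big residue xpredT) //=; apply: eq_bigr => r _.
rewrite rmorph_sum mulr_sumr; apply: eq_bigr => m /eqP <-.
rewrite -[in RHS]mul_mpolyC rmorphM /= (fpow_const (@mpolyC s k)) mulrCA mul_mpolyC; congr (_ *: _).
rewrite /fpow expn1 mpolyXn -mpolyXD; congr 'X_[_]; apply/mnmP => l.
by rewrite mnmDE mulmnE !mnmE ffunE /= addnC -divn_eq.
Qed.

Lemma msize_component r P E : (msize P <= E)%N -> (msize (component r P) <= E./2.+1)%N.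
Proof.
move=> PE; apply: leq_trans (msize_sum _ _ _) _.
rewrite big_seq_cond; elim/big_ind: _ => // [x y xE yE|m /andP[mP _]].
  by rewrite geq_max xE.
apply: leq_trans (mmeasureZ_le _ _ _) _; rewrite msizeX ltnS.
have m2 : (mdeg (quotient_mnm m) * 2 <= mdeg m)%N.
  rewrite !mdegE big_distrl leq_sum // => l _; rewrite mnmE.
  apply: leq_trans (leq_trunc_div (m l) q).
  by rewrite leq_mul2l card_gt1 orbT.
rewrite -divn2 leq_divRL //; apply: leq_trans m2 _.
by apply: leq_trans PE; apply: ltnW; apply: msize_mdeg_lt.
Qed.

End FrobeniusComponents.

Section FiniteAutomaton.
Variables (k : finFieldType) (K : fieldType) (iK : {rmorphism k -> K}) (s : nat).
Local Notation R := {mpoly k[s]}.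
Variables (theta : {rmorphism R -> K}) (g d : nat).
Local Notation N := #|{: {ffun 'I_g -> 'I_d}}|.
Local Notation iR := (@mpolyC s k : {rmorphism k -> R}).
Local Notation mon := (@monomials g d R).

Lemma msizeM_add (P P' : R) : (msize (P * P') <= msize P + msize P')%N.
Proof.
have [->|P0] := eqVneq P 0; first by rewrite mul0r msize0.
have [->|P'0] := eqVneq P' 0; first by rewrite mulr0 msize0.
by rewrite msizeM // leq_pred.
Qed.

Lemma msize_sum_bound (I : Type) (r : seq I) (F : I -> R) E :
  (forall t, msize (F t) <= E)%N -> (msize (\sum_(t <- r) F t) <= E)%N.
Proof.
move=> FE; apply: leq_trans (msize_sum _ _ _) _.
by elim/big_ind: _ => // x y xE yE; rewrite geq_max xE.
Qed.

Lemma msize_bounded (I : finType) (F : I -> R) :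
  exists E, forall t, (msize (F t) <= E)%N.
Proof. by exists (\max_t msize (F t)) => t; apply: leq_bigmax. Qed.

Definition bounded E (c : 'cV[R]_N) := forall l, (msize (c l ord0) <= E)%N.

Definition kills (c : 'cV[R]_N) (x : 'rV[R]_g) : Prop := map_mx theta (mon x *m c) = 0.

(** Split [b] into components: its product with F([mon x]) is a combination of q-th powers, to which
    [frobenius_relations] applies. The constant [eta] bounds the degrees of the relations and is
    chosen before [E] and [b]. *)
Lemma kills_frob : exists eta, forall E (b : 'cV[R]_N), bounded E b ->
  exists m (B : 'I_m -> 'cV[R]_N), (forall t, bounded (E./2.+1 + eta) (B t)) /\
    forall x, map_mx theta (frobp iR 1 (mon x) *m b) = 0 <-> forall t, kills (B t) x.
Proof.
pose m := #|{: {ffun 'I_s -> 'I_#|k|}}|.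
pose y (r : 'I_m) : K := theta 'X_[residue_mnm (enum_val r)].
have [C CP] := frobenius_relations iK theta y.
have [eta etaP] := msize_bounded (fun t : 'I_m * 'I_m => C t.1 t.2).
exists eta => E b bE.
pose comp (r : 'I_m) : 'cV[R]_N := map_mx (component (enum_val r)) b.
exists m, (fun t => \sum_r C r t *: comp r); split=> [t l|x].
  rewrite summxE; apply: msize_sum_bound => r; rewrite !mxE.
  apply: leq_trans (msizeM_add _ _) _; rewrite addnC; apply: leq_add.
    exact: msize_component.
  exact: (etaP (r, t)).
pose z : 'rV[R]_m := \row_r (mon x *m comp r) 0 0.
have zC t : (z *m C) 0 t = (mon x *m \sum_r C r t *: comp r) 0 0.
  rewrite mulmx_sumr summxE mxE; apply: eq_bigr => r _.
  by rewrite -scalemxAr !mxE mulrC.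
have zE : theta ((frobp iR 1 (mon x) *m b) 0 0)
        = \sum_r y r * fpow iK 1 (theta (z 0 r)).
  under [RHS]eq_bigr => r _ do
    rewrite /y -(fpow_rmorph iR) -rmorphM mxE mxE rmorph_sum mulr_sumr /=.
  rewrite -rmorph_sum exchange_big mxE; congr (theta _); apply: eq_bigr => l _ /=.
  rewrite [frobp _ _ _ _ _]mxE [b l 0]component_decomposition mulr_sumr.
  rewrite [RHS](reindex (@enum_rank _)) /=; last first.
    by exists enum_val => ? _; rewrite (enum_rankK, enum_valK).
  by apply: eq_bigr => r _; rewrite [comp _ _ _]mxE enum_rankK rmorphM mulrCA.
have <- : theta ((frobp iR 1 (mon x) *m b) 0 0) = 0 <->
          map_mx theta (frobp iR 1 (mon x) *m b) = 0.
  split=> [e|/matrixP/(_ 0 0)]; last by rewrite !mxE.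
  by apply/matrixP=> l l'; rewrite !ord1 [LHS]mxE e mxE.
rewrite zE CP; split=> [/rowP e t|e].
  by apply/matrixP=> l l'; rewrite !ord1 [LHS]mxE -zC; have := e t; rewrite !mxE.
by apply/rowP=> t; rewrite [LHS]mxE zC; have /matrixP/(_ 0 0) := e t; rewrite !mxE.
Qed.

(* Taking components halves the degree of the columns, so their degree stays
   bounded along all words; over the finite field [k] there are then only
   finitely many columns. *)
Lemma finite_automaton (D : finType) (dig : D -> 'rV[R]_g) (c0 : seq 'cV[R]_N) :
  exists (Q : finType) (delta : Q -> D -> Q) (cols : Q -> seq 'cV[R]_N) (q0 : Q),
    (forall x, (forall c, c \in cols q0 -> kills c x) <->
               (forall c, c \in c0 -> kills c x)) /\
    (forall q t x, (forall c, c \in cols (delta q t) -> kills c x) <->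
       (forall c, c \in cols q -> kills c (dig t + frobp iR 1 x))).
Proof.
have [eta frobP] := kills_frob.
have [tau tauP] := msize_bounded
  (fun t : D * ('I_N * 'I_N) => translation d (dig t.1) t.2.1 t.2.2).
have [e0 e0P] := msize_bounded (fun t : 'I_(size c0) * 'I_N => c0`_t.1 t.2 0).
(* Chosen so that [(tau + E)./2.+1 + eta <= E]: a transition keeps the bound [E]. The summand [e0]
   accommodates the initial columns. *)
pose E := (tau + eta.*2.+2 + e0)%N.
pose J := {ffun 'I_N -> {ffun 'X_{1..s < E} -> k}}.
pose col (j : J) : 'cV[R]_N := \col_l \sum_m j l m *: 'X_[m].
have col_bounded (j : J) : bounded E (col j).
  move=> l; rewrite mxE; apply: msize_sum_bound => m.
  by apply: leq_trans (mmeasureZ_le _ _ _) _; rewrite msizeX bmdeg.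
have colP c : bounded E c -> exists j, col j = c.
  move=> cE; exists [ffun l => [ffun m : 'X_{1..s < E} => (c l 0)@_m]].
  apply/colP => l; rewrite mxE [RHS](mpolywE (cE l)); apply: eq_bigr => m _.
  by rewrite !ffunE.
have step (j : J) (t : D) : exists A : {set J}, forall x,
    (forall j', j' \in A -> kills (col j') x) <-> kills (col j) (dig t + frobp iR 1 x).
  have bE : bounded (tau + E) (translation d (dig t) *m col j).
    move=> l; rewrite mxE; apply: msize_sum_bound => l'.
    apply: leq_trans (msizeM_add _ _) _; apply: leq_add; last exact: col_bounded.
    exact: (tauP (t, (l, l'))).
  have [m [B [BE BP]]] := frobP _ _ bE.
  have /fin_all_exists[f fP] r : exists j', col j' = B r.
    apply: colP => l; apply: leq_trans (BE r l) _.
    by rewrite /E; lia.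
  exists [set f r | r in 'I_m] => x.
  have -> : kills (col j) (dig t + frobp iR 1 x) <-> forall r, kills (B r) x.
    rewrite -BP /kills monomials_add -mulmxA.
    by rewrite /frobp map_monomials.
  split=> H => [r|_ /imsetP[r _ ->]]; last by rewrite fP.
  by rewrite -fP; apply: H; apply: imset_f.
have /fin_all_exists[F FP] (j : J) : exists f : D -> {set J}, forall t x,
    (forall j', j' \in f t -> kills (col j') x) <-> kills (col j) (dig t + frobp iR 1 x).
  by have [f fP] := fin_all_exists (step j); exists f.
(* A state is a set of columns, read as a conjunction of equations; its successor is the union of
   the successors of its members. *)
exists ({set J} : finType), (fun (q : {set J}) t => \bigcup_(j in q) F j t),
  (fun q : {set J} => [seq col j | j in q]), [set j | col j \in c0]; split=> [x|q t x].
  split=> H c; last by case/imageP => j; rewrite inE => cj ->; apply: H.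
  move=> cc0; have [j cj] : exists j, col j = c.
    apply: colP => l; move: cc0; rewrite -index_mem => ic.
    have := e0P (Ordinal ic, l); rewrite /= nth_index -?index_mem //.
    by move/leq_trans; apply; rewrite leq_addl.
  by apply: H; apply/imageP; exists j; rewrite ?inE ?cj.
split=> H _ /imageP[j jq ->].
  apply/FP => j' j'F; apply: H; apply/imageP; exists j' => //.
  by apply/bigcupP; exists j.
case/bigcupP: jq => j' j'q jF; apply: (proj2 (FP j' t x)) jF.
by apply: H; apply/imageP; exists j'.
Qed.

End FiniteAutomaton.

(** * Submodules over [A[F]] as sets of values of words *)

(** [phi] is a ring morphism, with no [k]-linearity assumed. It sends constants of [A] to constants,
    injectively, and an injection of the finite field [k] into itself is onto. *)
Lemma drinfeld_constants (k : finFieldType) (kb : fieldType) (ib : {rmorphism k -> kb})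
    (n : nat) (S : seq {mpoly k[n.+1]}) (E : fieldType) (iE : {rmorphism k -> E})
    (xi : 'I_n.+1 -> E) (yoo : 'I_n.+1 -> kb) (A : comNzRingType)
    (j : {rmorphism A -> E}) (phi : {rmorphism A -> {poly k}}) :
  is_ring_regular_away ib S iE xi yoo j -> forall c : k, exists a, phi a = c%:P.
Proof.
case=> j_inj jP; have /fin_all_exists[a aP] c : exists a, j a = iE c.
  apply/jP => y _ _; exists 0%N, c%:MP, 1; split.
  - by rewrite -[c%:MP]mulr1 mul_mpolyC; apply: dhomogZ; apply: dhomog1.
  - exact: dhomog1.
  - by rewrite /evalp rmorph1 oner_eq0.
  by rewrite /evalp rmorph1 divr1 mmapC.
have /fin_all_exists[sg sgP] c : exists c', phi (a c) = c'%:P.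
  have aq : phi (a c) ^+ #|k| = phi (a c).
    rewrite -rmorphXn; congr (phi _); apply: j_inj.
    by rewrite rmorphXn aP -rmorphXn expf_card.
  (* [phi (a c)] equals its own q-th power, whose degree is q times as large, so it is constant. *)
  exists (phi (a c))`_0; apply: size1_polyC; have := size_exp (phi (a c)) #|k|; rewrite aq.
  have := finNzRing_gt1 k; case: (size _) => [|[|t]] //= k1 /eqP.
  by rewrite ltn_eqF // ltn_Pmulr.
have sg_inj : injective sg.
  move=> c c' eqc; apply/eqP; rewrite -subr_eq0; apply/negP => /negP nz.
  have : phi ((a c - a c') * a (c - c')^-1) = 1.
    rewrite -[RHS](rmorph1 phi); congr (phi _); apply: j_inj.
    by rewrite rmorphM rmorphB !aP -rmorphB -rmorphM divff // !rmorph1.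
  rewrite rmorphM rmorphB !sgP eqc subrr mul0r => /eqP.
  by rewrite eq_sym oner_eq0.
by move=> c; have [sg' _ sgK] := injF_bij sg_inj; exists (a (sg' c)); rewrite sgP sgK.
Qed.

Lemma subgroupD (V : zmodType) (H : V -> Prop) x y :
  is_subgroup H -> H x -> H y -> H (x + y).
Proof.
move=> [H0 HB] Hx Hy; rewrite -[y]opprK; apply: (HB) => //.
by rewrite -sub0r; apply: HB.
Qed.

Section Submodule.
Variables (k : finFieldType) (A : comNzRingType) (phi : {rmorphism A -> {poly k}}).
Variables (K : fieldType) (iK : {rmorphism k -> K}) (g : nat).
Hypothesis phi_const : forall c : k, exists a, phi a = c%:P.
Implicit Types (G : 'rV[K]_g -> Prop).

Lemma AF_submodule_scale G c v : is_AF_submodule phi iK G -> G v -> G (iK c *: v).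
Proof.
case=> -[G0 _] Gphi _ Gv; have [a ea] := phi_const c.
have := Gphi a v Gv; rewrite ea /skew_act size_polyC.
case: eqP => [->|_] /=; first by rewrite [iK 0]rmorph0 scale0r.
by rewrite big_ord_recl big_ord0 addr0 coefC.
Qed.

Lemma AF_submoduleI G : is_subgroup G -> (forall c v, G v -> G (iK c *: v)) ->
  (forall v, G v -> G (frob k v)) -> is_AF_submodule phi iK G.
Proof.
move=> Gs GZ GF; split=> // a v Gv; rewrite /skew_act.
elim/big_ind: _ => [|x y|l _]; [by case: Gs|exact: subgroupD|].
by apply: GZ; elim: (l : nat) => //= t; apply: GF.
Qed.

Variable s : seq 'rV[K]_g.
Local Notation D := {ffun 'I_(size s) -> k}.

Definition combination (c : D) : 'rV[K]_g := \sum_l iK (c l) *: s`_l.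

Lemma combination_scale (c : D) (t : k) : iK t *: combination c = combination [ffun l => t * c l].
Proof.
rewrite /combination scaler_sumr; apply: eq_bigr => l _.
by rewrite ffunE rmorphM scalerA.
Qed.

Lemma ev_scale t w : exists w', iK t *: ev iK combination w = ev iK combination w'.
Proof.
elim: w => [|c w [w' IH]]; first by exists [::]; rewrite scaler0.
exists ([ffun l => t * c l] :: w'); rewrite /= -IH -combination_scale scalerDr.
by congr (_ + _); rewrite /frobp map_mxZ /= fpow_const.
Qed.

(** The digits are closed under subtraction, so words are subtracted letter by letter without
    carries. *)
Lemma ev_sub w1 w2 : exists w,
  ev iK combination w1 - ev iK combination w2 = ev iK combination w.
Proof.
elim: w1 w2 => [|c1 w1 IH] [|c2 w2].
- by exists [::]; rewrite subr0.
- have [w ew] := ev_scale (-1) (c2 :: w2).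
  by exists w; rewrite -ew rmorphN1 scaleN1r sub0r.
- by exists (c1 :: w1); rewrite subr0.
have [w ew] := IH w2; exists ([ffun l => c1 l - c2 l] :: w) => /=.
rewrite -ew raddfB opprD addrACA; congr (_ + _); rewrite /combination -sumrB.
by apply: eq_bigr => l _; rewrite ffunE rmorphB scalerBl.
Qed.

(** The values of words over [k]-combinations of the generators form an [A[F]]-submodule containing
    the generators, so minimality of [G] applies. *)
Lemma submodule_words G : is_AF_submodule phi iK G -> (forall v, v \in s -> G v) ->
  (forall G', is_AF_submodule phi iK G' -> (forall v, v \in s -> G' v) ->
      forall v, G v -> G' v) ->
  (forall c, G (combination c)) /\ (forall v, G v -> exists w, v = ev iK combination w).
Proof.
move=> GAF sG Gmin; split=> [c|].
  have [Gs _ _] := GAF; rewrite /combination.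
  elim/big_ind: _ => [|x y|l _]; [by case: Gs|exact: subgroupD|].
  by apply: AF_submodule_scale => //; apply/sG/mem_nth.
apply: Gmin; first apply: AF_submoduleI.
- split; first by exists [::].
  by move=> _ _ [w1 ->] [w2 ->]; apply: ev_sub.
- by move=> c _ [w ->]; apply: ev_scale.
- move=> _ [w ->]; exists ([ffun=> 0] :: w); rewrite /= -(iter_frob iK 1) /=.
  rewrite [combination _]big1 ?add0r // => l _.
  by rewrite ffunE rmorph0 scale0r.
move=> v vs; have vi : (index v s < size s)%N by rewrite index_mem.
exists [:: [ffun l => (l == Ordinal vi)%:R]]; rewrite /= raddf0 addr0.
rewrite /combination (bigD1 (Ordinal vi)) //= ffunE eqxx rmorph1 scale1r nth_index //.
by rewrite big1 ?addr0 // => l /negbTE nl; rewrite ffunE nl rmorph0 scale0r.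
Qed.

End Submodule.

(** * Lifting the data to a polynomial ring over [k], and the conclusion *)

(** [msize f <= d] forces every exponent below [d]. The entries of [c] are traced back to
    coefficients of [f] so that they can be lifted to polynomials over [k]. *)
Lemma evalp_monomials (K L : fieldType) (iL : {rmorphism K -> L}) (g d : nat)
    (f : {mpoly K[g]}) : (msize f <= d)%N ->
  exists c : 'cV[K]_#|{: {ffun 'I_g -> 'I_d}}|,
    (forall l, c l 0 = 0 \/ exists2 m, m \in msupp f & c l 0 = f@_m) /\
    forall v : 'rV[L]_g, monomials d v *m map_mx iL c = (evalp iL (fun l => v 0 l) f)%:M.
Proof.
move=> fd; pose mn (al : {ffun 'I_g -> 'I_d}) : 'X_{1..g} := [multinom (al l : nat) | l < g].
exists (\col_l f@_(mn (enum_val l))); split=> [l|v].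
  rewrite mxE; have [mf|/memN_msupp_eq0 ->] := boolP (mn (enum_val l) \in msupp f).
    by right; exists (mn (enum_val l)).
  by left.
have fE : f = \sum_al f@_(mn al) *: 'X_[mn al].
  apply/mpolyP => m; rewrite raddf_sum /=.
  under eq_bigr => al _ do rewrite mcoeffZ mcoeffX.
  have [mf|mf] := boolP (m \in msupp f); last first.
    rewrite (memN_msupp_eq0 mf) big1 // => al _.
    by case: eqP => [->|_]; rewrite ?(memN_msupp_eq0 mf) ?mul0r ?mulr0.
  have mlt l : (m l < d)%N.
    apply: leq_trans fd; apply: leq_ltn_trans (msize_mdeg_lt mf).
    by rewrite mdegE (bigD1 l) //= leq_addr.
  pose al0 : {ffun 'I_g -> 'I_d} := [ffun l => Ordinal (mlt l)].
  have mn0 : mn al0 = m by apply/mnmP => l; rewrite mnmE ffunE.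
  rewrite (bigD1 al0) //= mn0 eqxx mulr1 big1 ?addr0 // => al nal.
  case: eqP => [e|_]; last by rewrite mulr0.
  case/eqP: nal; apply/ffunP => l; apply: val_inj.
  by rewrite ffunE /= -e mnmE.
rewrite [X in evalp _ _ X]fE; apply/matrixP=> a b; rewrite !ord1 !mxE eqxx mulr1n.
rewrite /evalp raddf_sum (reindex (@enum_rank _)) /=; last first.
  by exists enum_val => ? _; rewrite (enum_rankK, enum_valK).
apply: eq_bigr => al _; rewrite mmapZ mmapX !mxE enum_rankK mulrC /mmap1.
by congr (_ * _); apply: eq_bigr => l _; rewrite mnmE.
Qed.

Lemma lift_to_polynomials (k : finFieldType) (K : fieldType) (iK : {rmorphism k -> K})
    (l : seq K) : exists (s : nat) (theta : {rmorphism {mpoly k[s]} -> K}),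
  (forall c, theta c%:MP = iK c) /\ forall x, x \in l -> exists P, theta P = x.
Proof.
exists (size l), (mmap iK (fun t => l`_t) : {rmorphism {mpoly k[size l]} -> K}).
split=> [c|x xl]; first by rewrite /= mmapC.
have xi : (index x l < size l)%N by rewrite index_mem.
by exists 'X_(Ordinal xi); rewrite /= mmapX mmap1U nth_index.
Qed.

Lemma good_Fset (k : finFieldType) (L : fieldType) (i : {rmorphism k -> L}) (g M : nat)
    (G U : 'rV[L]_g -> Prop) : (0 < M)%N -> good i G M U -> Fset_in k G U.
Proof.
move=> M0 [m [b [a [H [Gb Hs HG HF UP]]]]].
exists (fun v => exists e, v = b + orbit_sum i M a e), H; split=> //.
- exists m, b, a, (fun=> M); split=> // v.
  split=> -[e ->]; exists e; congr (_ + _); apply: eq_bigr => l _;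
    by rewrite (iter_frob i).
- by move=> _ [e ->].
move=> v; rewrite UP; split=> [[e [h [Hh ->]]]|[_ [h [[e ->] Hh ->]]]].
  by exists (b + orbit_sum i M a e), h; split=> //; exists e.
by exists e, h.
Qed.

Theorem theorem2p7
  (k : finFieldType)
  (kb : fieldType) (ib : {rmorphism k -> kb}) (hkb : algebraic_closure_of ib)
  (n : nat) (S : seq {mpoly k[n.+1]})
  (E : fieldType) (iE : {rmorphism k -> E}) (xi : 'I_n.+1 -> E)
  (hC : nonsingular_projective_curve ib S iE xi)
  (yoo : 'I_n.+1 -> kb) (hoo : on_curve ib S yoo)
  (A : comNzRingType) (j : {rmorphism A -> E})
  (hA : is_ring_regular_away ib S iE xi yoo j)
  (phi : {rmorphism A -> {poly k}}) (hphi : is_drinfeld_module phi)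
  (K : fieldType) (iK : {rmorphism k -> K})
  (L : fieldType) (iL : {rmorphism K -> L}) (hL : algebraic_closure_of iL)
  (hK : regular_extension iK iL)
  (g : nat) (hg : (0 < g)%N)
  (Gamma : 'rV[K]_g -> Prop) (hGamma : fin_gen_AF_submodule phi iK Gamma)
  (X : 'rV[L]_g -> Prop) (hX : affine_subvariety iL X) :
  exists (r : nat) (U : 'I_r -> 'rV[L]_g -> Prop),
    (forall s, Fset_in k (in_closure iL Gamma) (U s)) /\
    forall v : 'rV[L]_g,
      in_closure iL (fun u => rational_points iL X u /\ Gamma u) v
      <-> exists s, U s v.
Proof.
have const := regular_constants hK.
have phi_const := drinfeld_constants phi hA.
have [GAF [gens [gensG gensmin]]] := hGamma.
have [Gcomb Gwords] := submodule_words phi_const GAF gensG gensmin.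
have [T TP] := hX.
pose i : {rmorphism k -> L} := iL \o iK.
pose l1 := flatten [seq [seq v 0 l | l <- enum 'I_g] | v : 'rV[K]_g <- gens].
pose l2 := flatten [seq [seq f@_m | m <- msupp f] | f : {mpoly K[g]} <- T].
(* Only finitely many elements of [K] occur: coordinates of generators, coefficients of equations,
   and 0 for absent monomials. *)
have [s [theta [theta_const theta_l]]] := lift_to_polynomials iK (0 :: l1 ++ l2).
have lift_row (v : 'rV[K]_g) : (forall l, v 0 l \in 0 :: l1 ++ l2) ->
    exists vt, map_mx theta vt = v.
  move=> vl; have [P PP] := fin_all_exists (fun l => theta_l _ (vl l)).
  by exists (\row_l P l); apply/rowP=> l; rewrite !mxE.
have /fin_all_exists[gt gtP] (l : 'I_(size gens)) : exists vt, map_mx theta vt = gens`_l.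
  apply: lift_row => l'; rewrite inE mem_cat; apply/orP; right; apply/orP; left.
  apply/flatten_mapP; exists gens`_l; first exact: mem_nth.
  by apply: map_f; rewrite mem_enum.
pose D : finType := {ffun 'I_(size gens) -> k}.
pose digR (c : D) : 'rV[{mpoly k[s]}]_g := \sum_l (c l)%:MP *: gt l.
have digRE c : map_mx theta (digR c) = combination iK c.
  rewrite raddf_sum; apply: eq_bigr => l _.
  by rewrite /= map_mxZ gtP; congr (_ *: _); apply: theta_const.
have frobE m (v : 'rV[K]_g) : frobp i m (map_mx iL v) = map_mx iL (frobp iK m v).
  by apply/rowP=> l; rewrite !mxE (fpow_rmorph iK i).
have frobRE (v : 'rV[{mpoly k[s]}]_g) :
    map_mx theta (frobp (@mpolyC s k) 1 v) = frobp iK 1 (map_mx theta v).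
  by apply/rowP=> l; rewrite !mxE (fpow_rmorph _ iK).
have lift_G v : Gamma v -> exists x, v = map_mx theta x.
  move=> /Gwords[w ->]; elim: w => [|c w [x IH]] /=; first by exists 0; rewrite map_mx0.
  by exists (digR c + frobp (@mpolyC s k) 1 x); rewrite map_mxD digRE frobRE IH.
pose d := \max_(f <- T) msize f.
have /fin_all_exists[eqn eqnP] (t : 'I_(size T)) :
    exists c : 'cV[{mpoly k[s]}]_#|{: {ffun 'I_g -> 'I_d}}|, forall v : 'rV[L]_g,
    monomials d v *m map_mx iL (map_mx theta c) = (evalp iL (fun l => v 0 l) T`_t)%:M.
  have tT : T`_t \in T by apply: mem_nth.
  have td : (msize T`_t <= d)%N.
    by apply: (@leq_bigmax_seq _ _ xpredT (fun f : {mpoly K[g]} => msize f)).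
  have [c [c_coef cP]] := evalp_monomials iL td.
  have /fin_all_exists[P PP] l : exists P, theta P = c l 0.
    apply: theta_l; rewrite inE mem_cat; case: (c_coef l) => [->|[m mf ->]].
      by rewrite eqxx.
    by apply/or3P; apply: Or33; apply/flatten_mapP; exists T`_t => //;
      exact: (map_f (fun m => T`_t@_m) mf).
  exists (\col_l P l) => v; rewrite -cP; congr (_ *m map_mx _ _).
  by apply/colP => l; rewrite !mxE.
have [Q [delta [cols [q0 [q0P deltaP]]]]] :=
  finite_automaton iK theta digR [seq eqn t | t : 'I_(size T)].
have killsE (c : 'cV[{mpoly k[s]}]_#|{: {ffun 'I_g -> 'I_d}}|) x : kills theta c x <->
    monomials d (map_mx iL (map_mx theta x)) *m map_mx iL (map_mx theta c) = 0.
  rewrite -!map_monomials -!map_mxM /kills.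
  by split=> [->|/eqP]; rewrite ?map_mx0 // map_mx_eq0 => /eqP.
pose eqns q c' := exists2 c, c \in cols q & c' = map_mx iL (map_mx theta c).
pose Z q := annihilated (eqns q).
have ZE q x : Z q (map_mx iL (map_mx theta x)) <-> forall c, c \in cols q -> kills theta c x.
  split=> [Zx c cq|H _ [c cq ->]]; last by apply/killsE/H.
  by apply/killsE; apply: Zx; exists c.
pose G := in_closure iL Gamma; pose dig (c : D) : 'rV[L]_g := map_mx iL (combination iK c).
have [[Gamma0 GammaB] _ Gamma_frob] := GAF.
have G_subgroup : is_subgroup G.
  split; first by exists 0; rewrite ?map_mx0.
  move=> _ _ [x Gx ->] [y Gy ->]; exists (x - y); last by rewrite map_mxB.
  exact: GammaB.
have G_frob v : G v -> G (frobp i 1 v).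
  by case=> u Gu ->; rewrite frobE; exists (frobp iK 1 u);
    rewrite // -(iter_frob iK 1); apply: Gamma_frob.
have G_dig c : G (dig c) by exists (combination iK c).
have G_ev v : G v -> exists w, v = ev i dig w.
  case=> u /Gwords[w ->] ->; exists w; elim: w => [|c w IH] /=; first by rewrite map_mx0.
  by rewrite map_mxD -frobE IH.
have Z_closed q : is_closed d (Z q) by exists (eqns q).
have Z_delta q c v : G v -> (Z (delta q c) v <-> Z q (dig c + frobp i 1 v)).
  case=> u /lift_G[x ->] ->; rewrite ZE deltaP -ZE.
  by rewrite map_mxD digRE frobRE map_mxD -frobE.
(* [H] is pulled back to [K]-points, where regularity, through [const], yields stability under F
   itself. *)
have descent (H Y : 'rV[L]_g -> Prop) m : (0 < m)%N -> (forall v, H v -> G v) ->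
    (forall v, H v -> H (frobp i m v)) -> is_closed d Y ->
    (forall v, H v -> Y v) -> forall v, H v -> Y (frobp i 1 v).
  move=> m0 HG HF Yc HY v Hv; have [u _ eu] := HG v Hv; rewrite eu frobE.
  apply: (frobp_descent const (H := fun u => H (map_mx iL u)) m0 _ Yc) => [x Hx|x|].
  - by rewrite -frobE; apply: HF.
  - exact: HY.
  - by rewrite -eu.
have [M M0 M_loop] := common_loop_length delta.
have [I [U [gU UX XU]]] := cover_state (proj1 hL) G_subgroup G_frob G_dig G_ev
  Z_closed Z_delta descent M0 M_loop q0.
exists #|I|, (fun t => U (enum_val t)); split=> [t|v].
  exact: good_Fset M0 (gU _).
(* The initial state carries the equations of [X], so its language is the set to be covered. *)
have languageE : language G Z q0 v <->
    in_closure iL (fun u => rational_points iL X u /\ Gamma u) v.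
  have XE u : Gamma u -> rational_points iL X u <-> Z q0 (map_mx iL u).
    move=> /lift_G[x ->]; rewrite ZE q0P /rational_points TP.
    split=> [Xx _ /imageP[t _ ->]|H f fT].
      by apply/killsE; rewrite eqnP Xx ?scalar_mx0 ?mem_nth //;
        apply/matrixP => a b; rewrite !mxE mul0rn.
    have ft : (index f T < size T)%N by rewrite index_mem.
    have /killsE := H _ (image_f eqn (isT : Ordinal ft \in 'I_(size T))).
    rewrite eqnP /= nth_index // => /matrixP/(_ 0 0).
    by rewrite !mxE.
  split=> [[[u Gu ->] Zu]|[u [Xu Gu] ->]].
    by exists u => //; split=> //; apply/XE.
  by split; [exists u|apply/XE].
rewrite -languageE.
split=> [/XU[t Ut]|[t /UX//]].
by exists (enum_rank t); rewrite enum_rankK.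
Qed.
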